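(* Let $(X,d)$ be a separable geodesic Gromov-hyperbolic space with basepoint $o$, and $\mu$ a countably supported non-elementary probability measure on $\mathrm{Isom}(X)$ with a finite exponential moment. Then for every $x\in\overline X^h$, $$\lim_{\lambda\to0}\frac{\Lambda_x^-(\lambda)-\ell_\mu\lambda}{\lambda^2}=\lim_{\lambda\to0}\frac{\Lambda_x^+(\lambda)-\ell_\mu\lambda}{\lambda^2}=\frac{\sigma_\mu^2}{2}.$$
   Context: Gromov-hyperbolic: $\exists\delta\ge0$, $(x|y)_o\ge\min\{(x|z)_o,(z|y)_o\}-\delta$ with $(x|y)_o=\frac12(d(x,o)+d(y,o)-d(x,y))$. Non-elementary: the semigroup generated by $\mathrm{supp}\,\mu$ contains two loxodromic isometries with disjoint fixed point pairs on the Gromov boundary. $\kappa(g)=d(g\cdot o,o)$; finite exponential moment: $\exists\alpha>0$, $\int e^{\alpha\kappa}d\mu<\infty$. $\overline X^h$ is the horofunction compactification (closure of $\{h_x:m\mapsto d(x,m)-d(x,o)\}$ among 1-Lipschitz functions vanishing at $o$, pointwise convergence), with action $(g\cdot h)(m)=h(g^{-1}m)-h(g^{-1}o)$ and Busemann cocycle $\sigma(g,h)=h(g^{-1}o)$. $X_i$ i.i.d. with law $\mu$, $L_n=X_n\cdots X_1$, $\ell_\mu$ the a.s. limit of $\kappa(L_n)/n$. $\Lambda_x^+(\lambda)=\limsup_n\frac1n\log\mathbb E[e^{\lambda\sigma(L_n,x)}]$, $\Lambda_x^-(\lambda)=\liminf_n\frac1n\log\mathbb E[e^{\lambda\sigma(L_n,x)}]$.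 Fix a bounded measurable $\psi:\overline X^h\to\mathbb R$ (known to exist) such that $\sigma_0(g,x):=\sigma(g,x)+\psi(g\cdot x)-\psi(x)$ satisfies $\int\sigma_0(g,x)d\mu(g)=\ell_\mu$ for all $x$; then $\sigma_\mu^2=\iint(\sigma_0(g,y)-\ell_\mu)^2d\mu(g)d\nu(y)$ for any $\mu$-stationary probability $\nu$ on $\overline X^h$ (this is also the variance in the central limit theorem for $\kappa(L_n)$). *)

(* Defs.v *)
From HB Require Import structures.
From mathcomp Require Import all_boot all_order all_algebra.
From mathcomp Require Import all_classical all_reals all_analysis.
From mathcomp Require Import ring.
Set Implicit Arguments. Unset Strict Implicit. Unset Printing Implicit Defensive.
Import Order.TTheory GRing.Theory Num.Theory.
Import numFieldNormedType.Exports.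
Local Open Scope classical_set_scope.
Local Open Scope ring_scope.

Section Setup.
Variables (R : realType) (X : Type) (d : X -> X -> R) (o : X).

Definition is_metric : Prop :=
  [/\ forall x, d x x = 0,
      forall x y, d x y = 0 -> x = y,
      forall x y, d x y = d y x &
      forall x y z, d x z <= d x y + d y z].

Definition separable : Prop :=
  exists D : nat -> X, forall x (e : R), 0 < e -> exists n, d x (D n) < e.

Definition geodesic : Prop :=
  forall x y, exists gam : R -> X,
    [/\ gam 0 = x, gam (d x y) = y &
        forall s t, 0 <= s <= d x y -> 0 <= t <= d x y ->
          d (gam s) (gam t) = `|s - t|].

Definition gprod (x y : X) : R := (d x o + d y o - d x y) / 2.

Definition gromov_hyperbolic : Prop :=
  exists delta : R, 0 <= delta /\
    forall x y z, Num.min (gprod x z) (gprod z y) - delta <= gprod x y.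

Record isom := Isom {
  ifun : X -> X;
  iinv : X -> X;
  ifunK : cancel ifun iinv;
  iinvK : cancel iinv ifun;
  iisoP : forall x y, d (ifun x) (ifun y) = d x y }.

Definition iid : isom := @Isom id id (fun _ => erefl) (fun _ => erefl)
  (fun _ _ => erefl).

Lemma icomp_K (f g : isom) :
  cancel (ifun f \o ifun g) (iinv g \o iinv f).
Proof. by move=> x /=; rewrite ifunK ifunK. Qed.

Lemma icomp_KV (f g : isom) :
  cancel (iinv g \o iinv f) (ifun f \o ifun g).
Proof. by move=> x /=; rewrite iinvK iinvK. Qed.

Lemma icomp_iso (f g : isom) :
  forall x y, d ((ifun f \o ifun g) x) ((ifun f \o ifun g) y) = d x y.
Proof. by move=> x y /=; rewrite !iisoP. Qed.

Definition icomp (f g : isom) : isom :=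
  @Isom (ifun f \o ifun g) (iinv g \o iinv f) (icomp_K f g) (icomp_KV f g)
    (icomp_iso f g).

Definition kappa (g : isom) : R := d (ifun g o) o.

Definition loxodromic (f : isom) : Prop :=
  exists tau : R, 0 < tau /\
    (fun k : nat => d (iter k (ifun f) o) o / k%:R) @ \oo --> tau.

(** two sequences (converging to infinity) define the same point of the
    Gromov boundary *)
Definition same_bdry (a b : nat -> X) : Prop :=
  forall M : R, exists N : nat, forall k m, (N <= k)%N -> (N <= m)%N ->
    M <= gprod (a k) (b m).

(** attracting / repelling fixed points of f on the Gromov boundary,
    represented by the sequences (f^k o) and (f^-k o) *)
Definition fix_plus (f : isom) : nat -> X := fun k => iter k (ifun f) o.
Definition fix_minus (f : isom) : nat -> X := fun k => iter k (iinv f) o.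

Definition disjoint_fixed_pairs (f h : isom) : Prop :=
  [/\ ~ same_bdry (fix_plus f) (fix_plus h),
      ~ same_bdry (fix_plus f) (fix_minus h),
      ~ same_bdry (fix_minus f) (fix_plus h) &
      ~ same_bdry (fix_minus f) (fix_minus h)].

Definition word_isom (g : nat -> isom) (u : seq nat) : isom :=
  foldr (fun i acc => icomp (g i) acc) iid u.

(** mu = sum_n p n * delta_(g n) (countably supported).  Its support is
    {g n | p n > 0}; the semigroup it generates is the set of word_isom g u
    for nonempty words u with letters in the support. *)
Definition in_supp_semigroup (p : nat -> R) (g : nat -> isom) (f : isom) : Prop :=
  exists u : seq nat, u <> [::] /\ (forall i, i \in u -> 0 < p i) /\
    f = word_isom g u.

Definition non_elementary (p : nat -> R) (g : nat -> isom) : Prop :=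
  exists f h : isom, [/\ in_supp_semigroup p g f, in_supp_semigroup p g h,
    loxodromic f, loxodromic h & disjoint_fixed_pairs f h].

Definition hfun (x : X) : X -> R := fun m => d x m - d x o.

(** closure of {hfun x} for the topology of pointwise convergence *)
Definition is_horo (h : X -> R) : Prop :=
  forall (n : nat) (ms : 'I_n -> X) (e : R), 0 < e ->
    exists x : X, forall i : 'I_n, `|h (ms i) - hfun x (ms i)| < e.

Lemma is_horo_hfun x : is_horo (hfun x).
Proof. by move=> n ms e e0; exists x => i; rewrite subrr normr0. Qed.

Definition horo : Type := {h : X -> R | is_horo h}.

HB.instance Definition _ := gen_eqMixin horo.
HB.instance Definition _ := gen_choiceMixin horo.
HB.instance Definition _ := isPointed.Build horo
  (exist _ (hfun o) (is_horo_hfun o)).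

Definition hval (h : horo) : X -> R := proj1_sig h.

(** sigma-algebra on the horofunction compactification generated by the
    evaluation maps h |-> h m (= Borel sigma-algebra of the pointwise
    topology, X being separable) *)
Definition horo_gen : set (set horo) :=
  [set (fun h : horo => hval h m) @^-1` B | m in [set: X] &
     B in (@measurable _ R)].

Definition horoT := g_sigma_algebraType horo_gen.

Definition act_fun (g : isom) (h : X -> R) : X -> R :=
  fun m => h (iinv g m) - h (iinv g o).

Lemma is_horo_act (g : isom) (h : X -> R) : is_horo h -> is_horo (act_fun g h).
Proof.
move=> Hh n ms e e0.
have e20 : 0 < e / 2 by rewrite divr_gt0.
pose ms' : 'I_n.+1 -> X := fun i =>
  match unlift ord0 i with Some j => iinv g (ms j) | None => iinv g o end.
have [x Hx] := Hh n.+1 ms' (e / 2) e20.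
exists (ifun g x) => i.
have H1 := Hx (lift ord0 i); have H0 := Hx ord0.
rewrite /ms' liftK in H1; rewrite /ms' unlift_none in H0.
rewrite /act_fun /hfun.
have -> : d (ifun g x) (ms i) = d x (iinv g (ms i)).
  by rewrite -{1}(iinvK g (ms i)) iisoP.
have -> : d (ifun g x) o = d x (iinv g o).
  by rewrite -{1}(iinvK g o) iisoP.
rewrite /hfun in H1 H0.
set a := h (iinv g (ms i)) in H1 *; set b := h (iinv g o) in H0 *.
set u := d x (iinv g (ms i)) in H1 *; set v := d x (iinv g o) in H0 *.
have -> : a - b - (u - v) = (a - (u - d x o)) - (b - (v - d x o)) by ring.
apply: (le_lt_trans (ler_normB _ _)).
by rewrite (splitr e) ltrD.
Qed.

Definition act (g : isom) (h : horoT) : horoT :=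
  exist _ (act_fun g (hval h)) (is_horo_act g (proj2_sig h)).

Definition busemann (g : isom) (h : horoT) : R := hval h (iinv g o).

(** L_w^-1 o, where w = (w_0, ..., w_(n-1)) are the indices of X_1, ..., X_n,
    L_n = X_n ... X_1, so L_n^-1 o = X_1^-1 (... (X_n^-1 o)) *)
Definition word_inv_o (g : nat -> isom) n (w : {ffun 'I_n -> nat}) : X :=
  foldr (fun i acc => iinv (g (w i)) acc) o (enum 'I_n).

(** E[exp(lambda sigma(L_n, x))] for the i.i.d. random walk with law
    mu = sum_k p k delta_(g k) *)
Definition mgf (p : nat -> R) (g : nat -> isom) (x : horoT) (lam : R) (n : nat)
  : \bar R :=
  \esum_(w in [set: {ffun 'I_n -> nat}])
    ((\prod_(i < n) p (w i)) * expR (lam * hval x (word_inv_o g w)))%:E.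

Definition eln (y : \bar R) : \bar R :=
  match y with
  | EFin r => (ln r)%:E
  | +oo%E => +oo%E
  | -oo%E => -oo%E
  end.

Definition Lambda_plus p g x (lam : R) : \bar R :=
  limn_esup (fun n : nat => ((n%:R)^-1)%:E * eln (mgf p g x lam n))%E.

Definition Lambda_minus p g x (lam : R) : \bar R :=
  limn_einf (fun n : nat => ((n%:R)^-1)%:E * eln (mgf p g x lam n))%E.

(** L_n(omega) o = X_n(omega) (... (X_1(omega) o)) where X_i = g (I (i-1)) *)
Definition walk_o (g : nat -> isom) {Omega : Type} (I : nat -> Omega -> nat)
  (n : nat) (w : Omega) : X :=
  foldr (fun i acc => ifun (g (I i w)) acc) o (rev (iota 0 n)).

End Setup.

Arguments busemann {R X d} o g h.
Arguments act {R X d} o g h.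
Arguments mgf {R X d} o p g x lam n.
Arguments Lambda_plus {R X d} o p g x lam.
Arguments Lambda_minus {R X d} o p g x lam.

(* Main.v *)
Require Import Defs.
From HB Require Import structures.
From mathcomp Require Import all_boot all_order all_algebra.
From mathcomp Require Import all_classical all_reals all_analysis.
From mathcomp Require Import measurable_realfun.
From mathcomp Require Import ring lra.
Set Implicit Arguments. Unset Strict Implicit. Unset Printing Implicit Defensive.
Import Order.TTheory GRing.Theory Num.Theory.
Import numFieldNormedType.Exports.
Local Open Scope classical_set_scope.
Local Open Scope ring_scope.

(** Put [f k y = sigma_0(g_k, y) - ell].  For every [y] the process
   [M_n(y) = sigma_0(L_n, y) - n ell] is a martingale with increments [f],
   dominated by a variable with exponential moments.

   Starting from the horofunction [h_o] one has [sigma(L_n, h_o) = kappa(L_n)],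
   which dominates [sigma(L_n, y)] for all [y] since horofunctions are
   1-Lipschitz.  So [M_n(h_o) - M_n(y)] is bounded below and centred, hence
   bounded in L^1 uniformly in [n] and [y].  Fourth moments of size [n^2] turn
   this into [E M_n(h_o)^2 - E M_n(y)^2 = o(n)] uniformly in [y]; as [nu] is
   stationary, [E M_n(y)^2 / n] converges uniformly to [sigma_mu^2].

   If [P] is the Markov operator, [phi(y) = E f(y)^2] and [u] is the average of
   [E M_n(.)^2] over [n < N], then [phi + P u - u = E M_N(.)^2 / N], which is
   close to the constant [sigma_mu^2].  Therefore
   [exp (lam psi + lam^2 u / 2)] is almost an eigenfunction of the operator
   tilted by [exp (lam sigma)], with eigenvalue
   [exp (lam ell + lam^2 sigma_mu^2 / 2 + o(lam^2))]. *)

(** * Elementary bounds for the exponential *)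

Lemma exprn_le_expR (R : realType) (c x : R) (n : nat) : 0 < c -> 0 <= x ->
  x ^+ n <= n`!%:R / c ^+ n * expR (c * x).
Proof.
move=> c0 x0; have cx : 0 <= c * x by rewrite mulr_ge0// ltW.
rewrite mulrAC ler_pdivlMr ?exprn_gt0// -exprMn (mulrC x) [leRHS]mulrC.
rewrite -ler_pdivrMr ?ltr0n ?fact_gt0//.
case: n => [|n]; last by apply: le_trans (expR_ge1Dxn n cx); rewrite lerDr.
by rewrite expr0 fact0 divr1 -expR0 ler_expR.
Qed.

(** Since [(i + 3)! >= i!], the exponential series from index 3 on is dominated termwise by
    [|t| ^+ 3] times the series of [expR |t|]. *)
Lemma expR_taylor3 (R : realType) (t : R) :
  `|expR t - (1 + t + t ^+ 2 / 2)| <= `|t| ^+ 3 * expR `|t|.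
Proof.
have cv : series (exp_coeff t) @ \oo --> expR t by exact: is_cvg_series_exp_coeff.
have cv' : (fun n => `|series (exp_coeff t) n - (1 + t + t ^+ 2 / 2)|) @ \oo
    --> `|expR t - (1 + t + t ^+ 2 / 2)|.
  by apply: cvg_norm; apply: cvgB => //; exact: cvg_cst.
rewrite -(cvg_lim _ cv')//; apply: limr_le; first by apply/cvg_ex; eexists; exact: cv'.
near=> N.
have N3 : (3 <= N)%N by near: N; exists 3%N.
rewrite /series/= (big_cat_nat _ N3)//= !big_nat_recr//= big_geq//.
rewrite /exp_coeff /= expr0 expr1 !divr1 add0r.
rewrite (_ : 2`!%:R = 2 :> R)//. set A := 1 + t + _; rewrite (addrC A) addrK {A}.
rewrite -{1}(add0n 3%N) big_addn.
apply: le_trans (ler_norm_sum _ _ _) _.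
apply: (@le_trans _ _ (\sum_(0 <= i < N - 3) `|t| ^+ 3 * exp_coeff `|t| i)).
  apply: ler_sum => i _; rewrite normrM normrX normfV normr_nat addnC exprD.
  rewrite /exp_coeff /= -mulrA ler_wpM2l ?exprn_ge0// ler_wpM2l ?exprn_ge0//.
  rewrite lef_pV2 ?posrE ?ltr0n ?fact_gt0// ler_nat.
  by apply: leq_fact; rewrite leq_addl.
rewrite -mulr_sumr ler_wpM2l ?exprn_ge0//.
apply: nondecreasing_cvgn_le; last exact: is_cvg_series_exp_coeff.
by apply: nondecreasing_series => n _ _; exact: exp_coeff_ge0.
Unshelve. all: by end_near. Qed.

(** * Expectations over one step and over words of independent steps *)

Section Expectation.
Variables (R : realType) (p G : nat -> R).
Hypothesis p_ge0 : forall k, 0 <= p k.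
Hypothesis p_sum1 : series p @ \oo --> (1 : R).
Hypothesis G_ge1 : forall k, 1 <= G k.
Hypothesis pG_cvg : cvgn (series (fun k => p k * G k)).

(** The limit is meaningful only for a convergent series, so linearity and monotonicity below are
    stated for [dominated] sequences. *)
Definition mean (a : nat -> R) : R := limn (series (fun k => p k * a k)).

Definition dominated (a : nat -> R) : Prop :=
  exists C, forall k, `|a k| <= C * G k.

Lemma dominated_cvg a : dominated a -> cvgn (series (fun k => p k * a k)).
Proof.
move=> [C aC]; apply: normed_cvg.
have C_ge0 : 0 <= C.
  rewrite leNgt; apply/negP => C0; have := le_trans (normr_ge0 _) (aC 0%N).
  by rewrite leNgt nmulr_rlt0// (lt_le_trans ltr01).
apply: (@series_le_cvg _ _ (fun k => C * (p k * G k))) => //.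
- by move=> n; rewrite /= normr_ge0.
- by move=> n; rewrite !mulr_ge0 ?p_ge0// (le_trans ler01).
- by move=> n /=; rewrite normrM ger0_norm// [leRHS]mulrCA ler_wpM2l.
- exact: is_cvg_seriesZ C pG_cvg.
Qed.

Lemma mean_cvg a l : series (fun k => p k * a k) @ \oo --> l -> mean a = l.
Proof. by move=> al; apply/cvg_lim. Qed.

Lemma dominated_lin a b x y : dominated a -> dominated b ->
  dominated (fun k => x * a k + y * b k).
Proof.
move=> [C aC] [D bD]; exists (`|x| * C + `|y| * D) => k.
rewrite (le_trans (ler_normD _ _))// !normrM mulrDl -!mulrA.
by rewrite lerD// ler_wpM2l.
Qed.

Lemma dominated_cst c : dominated (fun=> c).
Proof. by exists `|c| => k; rewrite ler_peMr. Qed.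

Lemma mean_lin a b x y : dominated a -> dominated b ->
  mean (fun k => x * a k + y * b k) = x * mean a + y * mean b.
Proof.
move=> /dominated_cvg ac /dominated_cvg bc; rewrite /mean.
have := lim_seriesD (is_cvg_seriesZ (k := x) ac) (is_cvg_seriesZ (k := y) bc).
rewrite (lim_seriesZ x ac) (lim_seriesZ y bc) => <-.
congr (limn (series _)); apply/funext => k.
by transitivity (x * (p k * a k) + y * (p k * b k)); first by ring.
Qed.

Lemma mean_cst c : mean (fun=> c) = c.
Proof.
apply: mean_cvg.
rewrite (_ : series _ = fun n => series p n * c); last first.
  by apply/funext => n; rewrite /series/= mulr_suml.
by rewrite -[X in _ --> X]mul1r; apply: cvgMr_tmp p_sum1.
Qed.

Lemma mean_le a b : dominated a -> dominated b -> (forall k, a k <= b k) ->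
  mean a <= mean b.
Proof.
move=> da db ab; apply: lim_series_le; [exact: dominated_cvg..|move=> k].
by rewrite ler_wpM2l.
Qed.

Lemma dominated_G C : dominated (fun k => C * G k).
Proof.
by exists `|C| => k; rewrite normrM (ger0_norm (le_trans ler01 (G_ge1 k))).
Qed.

Lemma meanZ a x : dominated a -> mean (fun k => x * a k) = x * mean a.
Proof.
move=> da; have := mean_lin x 0 da da; rewrite mul0r addr0 => <-.
by congr mean; apply/funext => k; rewrite mul0r addr0.
Qed.

Lemma mean_bound a C : (forall k, `|a k| <= C * G k) ->
  `|mean a| <= C * mean G.
Proof.
move=> aC; have da : dominated a by exists C.
have dG : dominated G by exists 1 => k; rewrite mul1r ger0_norm// (le_trans ler01).
rewrite ler_norml -mulNr -!meanZ//; apply/andP; split; apply: mean_le => //;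
  try exact: dominated_G.
- by move=> k; have := aC k; rewrite ler_norml mulNr => /andP[].
- by move=> k; have := aC k; rewrite ler_norml => /andP[].
Qed.

Lemma mean_G_ge0 : 0 <= mean G.
Proof.
rewrite -[0](mean_cst 0); apply: mean_le; first exact: dominated_cst.
- by exists 1 => k; rewrite mul1r ger0_norm// (le_trans ler01).
- by move=> k; rewrite (le_trans ler01).
Qed.

(* [wordmean n F] is the expectation of [F [:: X_1; ...; X_n]]. *)
Fixpoint wordmean (n : nat) (F : seq nat -> R) : R :=
  if n is m.+1 then mean (fun k => wordmean m (fun w => F (k :: w)))
  else F [::].

(** By independence the product weight has expectation [mean G ^+ n] over words of length [n], so
    domination survives integrating out one letter at a time. *)
Definition wdominated (F : seq nat -> R) : Prop :=
  exists C, forall w, `|F w| <= C * \prod_(i <- w) G i.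

Lemma wordmean_bound n F C : (forall w, `|F w| <= C * \prod_(i <- w) G i) ->
  `|wordmean n F| <= C * mean G ^+ n.
Proof.
elim: n F C => [|n IH] F C FC /=.
  by have := FC [::]; rewrite big_nil expr0.
rewrite exprSr mulrA; apply: mean_bound => k.
rewrite mulrAC; apply: IH => w.
by have := FC (k :: w); rewrite big_cons mulrA.
Qed.

Lemma wdominated_cons F k : wdominated F -> wdominated (fun w => F (k :: w)).
Proof.
move=> [C FC]; exists (C * G k) => w.
by have := FC (k :: w); rewrite big_cons mulrA.
Qed.

Lemma dominated_wordmean n F : wdominated F ->
  dominated (fun k => wordmean n (fun w => F (k :: w))).
Proof.
move=> [C FC]; exists (C * mean G ^+ n) => k.
rewrite mulrAC; apply: wordmean_bound => w.
by have := FC (k :: w); rewrite big_cons mulrA.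
Qed.

Lemma wordmean_lin n F H x y : wdominated F -> wdominated H ->
  wordmean n (fun w => x * F w + y * H w) = x * wordmean n F + y * wordmean n H.
Proof.
elim: n F H => [//|n IH] F H dF dH /=.
rewrite -mean_lin; [|exact: dominated_wordmean..].
by congr mean; apply/funext => k; apply: IH; exact: wdominated_cons.
Qed.

Lemma wordmean_le n F H : wdominated F -> wdominated H ->
  (forall w, F w <= H w) -> wordmean n F <= wordmean n H.
Proof.
elim: n F H => [|n IH] F H dF dH FH //=.
apply: mean_le; [exact: dominated_wordmean..|move=> k].
by apply: IH => //; exact: wdominated_cons.
Qed.

Lemma wordmean_cst n c : wordmean n (fun=> c) = c.
Proof.
elim: n => //= n IH; rewrite -[RHS]mean_cst.
by congr mean; apply/funext => k; exact: IH.
Qed.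

Lemma wdominated_lin F H x y : wdominated F -> wdominated H ->
  wdominated (fun w => x * F w + y * H w).
Proof.
move=> [C aC] [D bD]; exists (`|x| * C + `|y| * D) => w.
rewrite (le_trans (ler_normD _ _))// !normrM mulrDl -!mulrA.
by rewrite lerD// ler_wpM2l.
Qed.

Lemma wdominated_cst c : wdominated (fun=> c).
Proof.
exists `|c| => w; rewrite ler_peMr//.
by elim: w => [|k w IH]; rewrite ?big_nil// big_cons mulr_ege1.
Qed.

Lemma wdominated_norm F : wdominated F -> wdominated (fun w => `|F w|).
Proof. by move=> [C FC]; exists C => w; rewrite normr_id. Qed.

Lemma wordmean_norm n F : wdominated F ->
  `|wordmean n F| <= wordmean n (fun w => `|F w|).
Proof.
move=> dF; have dnF := wdominated_norm dF.
have E x : x * wordmean n (fun w => `|F w|) =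
    wordmean n (fun w => x * `|F w| + 0 * `|F w|).
  by rewrite wordmean_lin// mul0r addr0.
rewrite ler_norml; apply/andP; split.
- rewrite -mulN1r E; apply: wordmean_le => //; first exact: wdominated_lin.
  by move=> w; rewrite mul0r addr0 mulN1r lerNl -normrN ler_norm.
- by apply: wordmean_le => // w; exact: ler_norm.
Qed.

End Expectation.

(** * The centred martingale driven by i.i.d. maps on an abstract state space *)

Section Chain.
Variables (R : realType) (Y : Type) (T : nat -> Y -> Y) (f : nat -> Y -> R).
Variables (p b : nat -> R) (alpha : R).
Hypothesis p_ge0 : forall k, 0 <= p k.
Hypothesis p_sum1 : series p @ \oo --> (1 : R).
Hypothesis alpha_gt0 : 0 < alpha.
Hypothesis b_ge0 : forall k, 0 <= b k.
Hypothesis f_le : forall k y, `|f k y| <= b k.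
(** An integrable weight that dominates all powers of [f] and every [expR (lam * f)] with
    [|lam| <= alpha], uniformly in the state. *)
Let G k := expR (alpha * b k).
Hypothesis pG_cvg : cvgn (series (fun k => p k * G k)).
Hypothesis mean_f : forall y, mean p (f^~ y) = 0.

Let G_ge1 k : 1 <= G k.
Proof. by rewrite -[leLHS]expR0 ler_expR mulr_ge0// ltW. Qed.

Let mlin := mean_lin p_ge0 G_ge1 pG_cvg.
Let mle := mean_le p_ge0 G_ge1 pG_cvg.
Let mbound := mean_bound p_ge0 G_ge1 pG_cvg.
Let wlin := wordmean_lin p_ge0 G_ge1 pG_cvg.
Let wle := wordmean_le p_ge0 G_ge1 pG_cvg.
Let dcst := dominated_cst G_ge1.
Let wdcst := wdominated_cst G_ge1.

(** The head of the word is the first step in time, as in [wordmean]; conditioning on the first step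
    is then plain unfolding. *)
Fixpoint mart (w : seq nat) (y : Y) : R :=
  if w is k :: v then f k y + mart v (T k y) else 0.

Let bsum (w : seq nat) := \sum_(i <- w) b i.

Let bsum_ge0 w : 0 <= bsum w.
Proof. by rewrite sumr_ge0. Qed.

Let prod_G w : \prod_(i <- w) G i = expR (alpha * bsum w).
Proof. by rewrite mulr_sumr expR_sum. Qed.

Let mart_le w y : `|mart w y| <= bsum w.
Proof.
elim: w y => [|k w IH] y /=; first by rewrite normr0 /bsum big_nil.
by rewrite /bsum big_cons (le_trans (ler_normD _ _))// lerD.
Qed.

Let mart_expn_le (j : nat) w y :
  `|mart w y ^+ j| <= j`!%:R / alpha ^+ j * \prod_(i <- w) G i.
Proof.
rewrite prod_G normrX; apply: le_trans (exprn_le_expR j alpha_gt0 (bsum_ge0 w)).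
by rewrite lerXn2r// nnegrE.
Qed.

Let wd_expn j y : wdominated G (fun w => mart w y ^+ j).
Proof. by exists (j`!%:R / alpha ^+ j) => w; exact: mart_expn_le. Qed.

Let wd_mart y : wdominated G (mart^~ y).
Proof. exact: (wd_expn 1 y). Qed.

Let wd_exp s y : `|s| <= alpha -> wdominated G (fun w => expR (s * mart w y)).
Proof.
move=> sa; exists 1 => w; rewrite mul1r prod_G ger0_norm ?expR_ge0// ler_expR.
apply: le_trans (ler_norm _) _; rewrite normrM ler_pM//.
Qed.

Let d_bounded (u : Y -> R) y C : (forall y, `|u y| <= C) ->
  dominated G (fun k => u (T k y)).
Proof.
move=> uC; exists C => k; apply: le_trans (uC _) _.
by rewrite ler_peMr// (le_trans _ (uC y)).
Qed.

Let d_expn j y : dominated G (fun k => f k y ^+ j).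
Proof.
exists (j`!%:R / alpha ^+ j) => k; rewrite normrX.
apply: le_trans (exprn_le_expR j alpha_gt0 (b_ge0 k)).
by rewrite lerXn2r// nnegrE.
Qed.

Let d_f y : dominated G (f^~ y).
Proof. exact: (d_expn 1 y). Qed.

Lemma wordmean_mart n y : wordmean p n (mart^~ y) = 0.
Proof.
elim: n y => [//|n IH] y /=; rewrite -[RHS](mean_f y).
congr mean; apply/funext => k.
rewrite (_ : (fun w => _) = fun w => f k y * 1 + 1 * mart w (T k y)); last first.
  by apply/funext => w; rewrite mulr1 mul1r.
by rewrite wlin// wordmean_cst// IH mulr0 addr0 mulr1.
Qed.

(** This is the function [phi] of the overview, and [second_moment n] is its [E M_n(.)^2]. *)
Definition step_var (y : Y) : R := mean p (fun k => f k y ^+ 2).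
Definition second_moment (n : nat) (y : Y) : R := wordmean p n (fun w => mart w y ^+ 2).

Let step_var_ge0 y : 0 <= step_var y.
Proof.
by rewrite -[X in X <= _](mean_cst p_sum1 0); apply: mle => // k; exact: sqr_ge0.
Qed.

Lemma step_var_le y : step_var y <= 2 / alpha ^+ 2 * mean p G.
Proof.
apply: le_trans (ler_norm _) _; apply: mbound => k; rewrite normrX.
apply: le_trans (exprn_le_expR 2 alpha_gt0 (b_ge0 k)).
by rewrite lerXn2r// nnegrE.
Qed.

Lemma second_moment_bound n y : `|second_moment n y| <= 2 / alpha ^+ 2 * mean p G ^+ n.
Proof.
by apply: (wordmean_bound p_ge0 G_ge1 pG_cvg) => w; exact: (mart_expn_le 2).
Qed.

(** Martingale orthogonality: given the first letter [k], the cross term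
    [2 * f k y * mart w (T k y)] averages to zero. *)
Lemma second_momentS n y :
  second_moment n.+1 y = step_var y + mean p (fun k => second_moment n (T k y)).
Proof.
rewrite [LHS](_ : _ = mean p (fun k =>
  wordmean p n (fun w => (f k y + mart w (T k y)) ^+ 2)))//.
rewrite -[step_var y]mul1r -[mean p (fun k => second_moment n _)]mul1r /step_var -mlin//;
  last exact: d_bounded (second_moment_bound n).
congr mean; apply/funext => k; rewrite mul1r.
rewrite (_ : (fun w => _) = fun w => 1 * (f k y ^+ 2 * 1 +
    (2 * f k y) * mart w (T k y)) + 1 * mart w (T k y) ^+ 2); last first.
  by apply/funext => w /=; ring.
rewrite wlin//; last by apply: wdominated_lin.
by rewrite wlin// wordmean_cst// wordmean_mart mulr0 addr0 !mul1r mulr1.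
Qed.

(** The linear term disappears because [f] is centred. Restricting to [|lam| <= alpha / 2] keeps
    half of the exponential moment in reserve to absorb the cube in the Taylor remainder, so that
    [C] depends neither on [h], [y] nor [lam]. *)
Lemma mean_expand (D : R) : 0 <= D -> exists2 C, 0 <= C &
  forall (h : nat -> R) (y : Y) (lam : R), (forall k, `|h k| <= D) ->
    `|lam| <= 1 -> `|lam| <= alpha / 2 ->
    `|mean p (fun k => expR (lam * f k y + lam ^+ 2 * h k)) -
      (1 + lam ^+ 2 * (mean p h + step_var y / 2))| <= C * `|lam| ^+ 3.
Proof.
(* The first summand pays for the Taylor remainder, the second for the terms of order 3 and 4 in
   [lam] coming from the square of the exponent. *)
move=> D0; pose c := 3`!%:R / (alpha / 2) ^+ 3 + 2`!%:R / alpha ^+ 2 : R.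
have a20 : 0 < alpha / 2 by rewrite divr_gt0.
have c0 : 0 <= c by rewrite addr_ge0// divr_ge0// exprn_ge0// ltW.
pose C := c * expR (alpha * D).
have C0 : 0 <= C by rewrite mulr_ge0// expR_ge0.
exists (C * mean p G); first by rewrite mulr_ge0// (mean_G_ge0 _ p_sum1).
move=> h y lam hD lam1 lama.
have key k : `|expR (lam * f k y + lam ^+ 2 * h k) -
    (1 + lam * f k y + lam ^+ 2 * (h k + f k y ^+ 2 / 2))| <=
    `|lam| ^+ 3 * C * G k.
  set F := f k y; set H := h k; pose B := b k + D.
  have B0 : 0 <= B by rewrite addr_ge0.
  have tB : `|lam * F + lam ^+ 2 * H| <= `|lam| * B.
    rewrite (le_trans (ler_normD _ _))// !normrM mulrDr.
    rewrite lerD ?ler_wpM2l ?f_le// -mulrA ler_wpM2l//.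
    by rewrite -[leRHS]mul1r ler_pM// hD.
  set t := lam * F + lam ^+ 2 * H in tB *.
  rewrite (_ : expR t - _ = (expR t - (1 + t + t ^+ 2 / 2)) +
    (lam ^+ 3 * (F * H) + lam ^+ 4 * (H ^+ 2 / 2))); last by rewrite /t; field.
  rewrite (le_trans (ler_normD _ _))//.
  have e1 : `|expR t - (1 + t + t ^+ 2 / 2)| <=
      `|lam| ^+ 3 * (3`!%:R / (alpha / 2) ^+ 3 * expR (alpha * B)).
    apply: le_trans (expR_taylor3 t) _.
    apply: (@le_trans _ _ ((`|lam| * B) ^+ 3 * expR (alpha / 2 * B))).
      rewrite ler_pM ?exprn_ge0 ?expR_ge0//.
        by rewrite lerXn2r// nnegrE// mulr_ge0.
      by rewrite ler_expR (le_trans tB)// ler_wpM2r.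
    rewrite exprMn -[leLHS]mulrA ler_wpM2l ?exprn_ge0//.
    (* One half of the exponent [alpha * B] bounds [B ^+ 3], the other half is the exponential
       factor of the remainder. *)
    apply: (@le_trans _ _ (3`!%:R / (alpha / 2) ^+ 3 * expR (alpha / 2 * B) *
        expR (alpha / 2 * B))).
      by rewrite ler_wpM2r ?expR_ge0// exprn_le_expR.
    by rewrite -mulrA -expRD -mulrDl -splitr.
  have e2 : `|lam ^+ 3 * (F * H) + lam ^+ 4 * (H ^+ 2 / 2)| <=
      `|lam| ^+ 3 * (2`!%:R / alpha ^+ 2 * expR (alpha * B)).
    apply: (@le_trans _ _ (`|lam| ^+ 3 * B ^+ 2)); last first.
      by rewrite ler_wpM2l ?exprn_ge0// exprn_le_expR.
    rewrite (_ : lam ^+ 3 * (F * H) + lam ^+ 4 * (H ^+ 2 / 2) =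
      lam ^+ 3 * (F * H + lam * (H ^+ 2 / 2))); last by field.
    rewrite normrM normrX ler_wpM2l ?exprn_ge0//.
    rewrite (le_trans (ler_normD _ _))// !normrM -expr2.
    rewrite (ger0_norm (_ : 0 <= 2^-1)) ?invr_ge0//.
    have Fb := f_le k y; have Hh := hD k.
    rewrite -/F -/H in Fb Hh; rewrite /B.
    have := normr_ge0 F; have := normr_ge0 H; have := normr_ge0 lam.
    move: `|F| `|H| `|lam| (b k) Fb Hh lam1 D0 => {tB t e1 B B0 F H lama}.
    move=> x z l v xv zD l1 D0 l0 z0 x0.
    have h1 : x * z <= v * D by rewrite ler_pM.
    have h2 : z ^+ 2 <= D ^+ 2 by rewrite lerXn2r ?nnegrE.
    have h3 : l * (z ^+ 2 / 2) <= z ^+ 2 / 2.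
      by rewrite -[leRHS]mul1r ler_wpM2r// divr_ge0// sqr_ge0.
    have h4 : 0 <= v ^+ 2 by exact: sqr_ge0.
    have h5 : 0 <= v * D by rewrite mulr_ge0// (le_trans x0).
    have h6 : 0 <= D ^+ 2 by exact: sqr_ge0.
    by rewrite sqrrD; lra.
  apply: le_trans (lerD e1 e2) _.
  rewrite -mulrDr -mulrDl -/c /B mulrDr expRD /C !mulrA.
  by rewrite -(mulrA _ (expR _)) (mulrC (expR _)) !mulrA.
have dh : dominated G h.
  by exists D => k; rewrite (le_trans (hD k))// ler_peMr.
have E : 1 + lam ^+ 2 * (mean p h + step_var y / 2) =
    mean p (fun k => 1 + lam * f k y + lam ^+ 2 * (h k + f k y ^+ 2 / 2)).
  transitivity (mean p (fun k => 1 * (1 * 1 + lam * f k y) +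
      lam ^+ 2 * (1 * h k + 2^-1 * f k y ^+ 2))).
    rewrite !mlin//; [|exact: dominated_lin..].
    by rewrite mean_cst// mean_f -/(step_var y); field.
  by congr mean; apply/funext => k; ring.
have d2 : dominated G
    (fun k => 1 + lam * f k y + lam ^+ 2 * (h k + f k y ^+ 2 / 2)).
  rewrite (_ : (fun k => _) = (fun k => 1 * (1 * 1 + lam * f k y) +
      lam ^+ 2 * (1 * h k + 2^-1 * f k y ^+ 2))).
    by do 2?apply: dominated_lin.
  by apply/funext => k; ring.
set Q := (fun k => expR _); set P := fun k => 1 + _ + _ in E d2 *.
have dQP : dominated G (fun k => Q k - P k) by exists (`|lam| ^+ 3 * C).
have dQ : dominated G Q.
  rewrite (_ : Q = fun k => 1 * (Q k - P k) + 1 * P k); first exact: dominated_lin.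
  by apply/funext => k; ring.
rewrite E (_ : mean p Q - _ = mean p (fun k => Q k - P k)).
  by rewrite mulrC mulrA; exact: mbound.
rewrite -[mean p Q]mul1r -[mean p P]mul1r -mulNr -mlin//.
by congr mean; apply/funext => k; ring.
Qed.

(** A sub-Gaussian bound: [mean_expand] with [h = 0] bounds one step by [1 + O(s ^+ 2)], hence by
    [expR] of [O(s ^+ 2)], at every state; the steps then multiply. *)
Lemma wordmean_expR_mart : exists2 C, 0 <= C &
  forall s, `|s| <= 1 -> `|s| <= alpha / 2 -> forall n y,
    wordmean p n (fun w => expR (s * mart w y)) <= expR (C * s ^+ 2 * n%:R).
Proof.
have [C C0 HC] := mean_expand (lexx 0).
pose K := 2 / alpha ^+ 2 * mean p G; exists (K + C).
  rewrite addr_ge0// mulr_ge0//; last exact: (mean_G_ge0 _ p_sum1).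
  by rewrite divr_ge0// exprn_ge0// ltW.
move=> s s1 sa.
have sal : `|s| <= alpha by rewrite (le_trans sa)// ler_pdivrMr// ler_pMr// ler1n.
have step y : mean p (fun k => expR (s * f k y)) <= expR ((K + C) * s ^+ 2).
  have z0 (k : nat) : `|0 : R| <= 0 by rewrite normr0.
  have := HC (fun=> 0) y s z0 s1 sa.
  rewrite mean_cst// add0r; under eq_fun do rewrite mulr0 addr0.
  move=> /(le_trans (ler_norm _)); rewrite lerBlDr => /le_trans; apply.
  apply: le_trans (expR_ge1Dx _).
  have h1 : s ^+ 2 * (step_var y / 2) <= s ^+ 2 * K.
    rewrite ler_wpM2l ?sqr_ge0// (le_trans _ (step_var_le y))//.
    by rewrite ler_pdivrMr// ler_peMr// ler1n.
  have h2 : C * `|s| ^+ 3 <= C * s ^+ 2.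
    by rewrite ler_wpM2l// exprS -normrX (ger0_norm (sqr_ge0 s)) ler_piMl// sqr_ge0.
  by rewrite mulrDl addrCA lerD2l addrC mulrC (mulrC K) (mulrC (_ / 2)) lerD.
elim=> [|n IH] y /=; first by rewrite !mulr0.
apply: (@le_trans _ _ (mean p (fun k => expR ((K + C) * s ^+ 2 * n%:R) * expR (s * f k y)))).
  apply: mle.
  - exact: (dominated_wordmean p_ge0 G_ge1 pG_cvg n (wd_exp y sal)).
  - exists (expR ((K + C) * s ^+ 2 * n%:R)) => k.
    rewrite ger0_norm ?mulr_ge0 ?expR_ge0// ler_wpM2l ?expR_ge0// ler_expR.
    by rewrite (le_trans (ler_norm _))// normrM ler_pM.
  - move=> k; rewrite (_ : (fun w => _) =
      fun w => expR (s * f k y) * expR (s * mart w (T k y)) + 0 * 1); last first.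
      by apply/funext => w; rewrite mul0r addr0 mulrDr expRD.
    rewrite wlin//; last exact: wd_exp.
    by rewrite mul0r addr0 mulrC ler_wpM2r ?expR_ge0.
rewrite (meanZ p_ge0 G_ge1 pG_cvg); last first.
  exists 1 => k; rewrite mul1r ger0_norm ?expR_ge0// ler_expR.
  by rewrite (le_trans (ler_norm _))// normrM ler_pM.
by rewrite -natr1 mulrDr mulr1 expRD ler_wpM2l ?expR_ge0.
Qed.

(** At time [n = m ^ 2] the exponential moment with parameter [1 / m] is bounded, which forces
    fourth moments of order [n ^ 2]. Square times avoid square roots. *)
Lemma wordmean_mart4 : exists2 C, 0 <= C & forall m y, 1 <= m%:R :> R ->
  2 / alpha <= m%:R ->
  wordmean p (m ^ 2) (fun w => mart w y ^+ 4) <= C * m%:R ^+ 4.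
Proof.
have [C C0 HC] := wordmean_expR_mart.
exists (48 * expR C); first by rewrite mulr_ge0// expR_ge0.
move=> m y m1 ma; have m0 : 0 < m%:R :> R by rewrite (lt_le_trans ltr01).
pose s : R := m%:R^-1; have s0 : 0 < s by rewrite invr_gt0.
have s1 : `|s| <= 1 by rewrite gtr0_norm// invf_le1.
have sa : `|s| <= alpha / 2.
  by rewrite gtr0_norm// -[alpha / 2]invrK lef_pV2// ?posrE ?invr_gt0 ?divr_gt0// invf_div.
have sal : `|s| <= alpha by rewrite (le_trans sa)// ler_pdivrMr// ler_pMr// ler1n.
have bnd t : `|t| = s -> wordmean p (m ^ 2) (fun w => expR (t * mart w y)) <= expR C.
  move=> ts; have t1 : `|t| <= 1 by rewrite ts -(gtr0_norm s0).
  have ta : `|t| <= alpha / 2 by rewrite ts -(gtr0_norm s0).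
  apply: le_trans (HC t t1 ta (m ^ 2)%N y) _; rewrite ler_expR -mulrA.
  rewrite (_ : t ^+ 2 * _ = 1) ?mulr1//.
  have -> : t ^+ 2 = s ^+ 2 by rewrite -ts -normrX (ger0_norm (sqr_ge0 t)).
  by rewrite /s natrX -exprMn mulVf ?gt_eqF// expr1n.
have ds : wdominated G (fun w => expR (s * mart w y)) by exact: wd_exp.
have dNs : wdominated G (fun w => expR (- s * mart w y)).
  by apply: wd_exp; rewrite normrN.
have c0 : 0 <= 24 * m%:R ^+ 4 :> R by rewrite mulr_ge0// exprn_ge0// ltW.
(* [M ^+ 4] is at most [4! * m ^ 4 * expR (|M| / m)], and [expR |x|] is at most
   [expR x + expR (- x)]. *)
apply: (@le_trans _ _ (wordmean p (m ^ 2) (fun w =>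
    24 * m%:R ^+ 4 * expR (s * mart w y) + 24 * m%:R ^+ 4 * expR (- s * mart w y)))).
  apply: wle => //; first exact: wdominated_lin.
  move=> w; rewrite -mulrDr; set M := mart w y.
  have -> : M ^+ 4 = `|M| ^+ 4 by rewrite -normrX ger0_norm// exprn_even_ge0.
  apply: le_trans (exprn_le_expR 4 s0 (normr_ge0 M)) _.
  rewrite (_ : 4`!%:R / s ^+ 4 = 24 * m%:R ^+ 4); last first.
    by rewrite /s exprVn invrK.
  rewrite ler_wpM2l//; have [M0|M0] := leP 0 M.
    by rewrite ger0_norm// lerDl expR_ge0.
  by rewrite ltr0_norm// mulrN mulNr lerDr expR_ge0.
rewrite wlin// -mulrDr.
apply: (@le_trans _ _ (24 * m%:R ^+ 4 * (expR C + expR C))).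
  by rewrite ler_wpM2l// lerD// bnd// ?normrN gtr0_norm.
by rewrite le_eqVlt; apply/orP; left; apply/eqP; ring.
Qed.

(* If [mart w y0] almost dominates [mart w y], the two martingales stay within
   bounded distance in L^1; the fourth moment bound upgrades this to
   [E |M(y0)^2 - M(y)^2| = o(n)]. *)
Lemma second_moment_oscillation (y0 : Y) (c0 : R) : 0 <= c0 ->
  (forall w y, mart w y - c0 <= mart w y0) ->
  forall e, 0 < e -> exists2 N, (0 < N)%N &
    forall y y', `|second_moment N y - second_moment N y'| <= e * N%:R.
Proof.
move=> c0_ge0 Hy0 e e0; have [C C0 HC] := wordmean_mart4.
(* [del] makes the contribution below the truncation level at most [e / 4 * m ^ 2]; [B] is the
   contribution above it, which does not depend on [m]. *)
pose del := e / (8 * (c0 + 1)); have del0 : 0 < del.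
  by rewrite divr_gt0// mulr_gt0// ltr_wpDl.
pose B := 16 * C / del ^+ 2.
have B0 : 0 <= B by rewrite divr_ge0 ?sqr_ge0// mulr_ge0.
(* The term [2 / alpha] meets the requirement of the fourth moment bound, and [4 * B / e] gives
   [B <= e / 4 * m ^ 2]. *)
pose m := (Num.truncn (2 / alpha + 4 * B / e)).+1.
have mge : 2 / alpha + 4 * B / e <= m%:R by rewrite ltW// truncnS_gt.
have Be0 : 0 <= 4 * B / e by rewrite divr_ge0 ?(ltW e0)// mulr_ge0.
have a0 : 0 <= 2 / alpha by rewrite divr_ge0// ltW.
have m_a : 2 / alpha <= m%:R by rewrite (le_trans _ mge)// lerDl.
have m_e : 4 * B / e <= m%:R by rewrite (le_trans _ mge)// lerDr.
have m1 : 1 <= m%:R :> R by rewrite ler1n.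
have m0 : 0 < m%:R :> R by rewrite (lt_le_trans ltr01).
exists (m ^ 2)%N => [|y y']; first by rewrite expn_gt0.
suff H z : `|second_moment (m ^ 2) y0 - second_moment (m ^ 2) z| <= e / 2 * (m ^ 2)%:R.
  rewrite (le_trans (ler_distD (second_moment (m ^ 2) y0) _ _))// distrC.
  by rewrite (le_trans (lerD (H _) (H _)))// -mulrDl -splitr.
(* Truncation level for the sum of the absolute values of the two martingales, of the order of
   [n = m ^ 2]. *)
pose K := del * m%:R ^+ 2; have K0 : 0 < K by rewrite mulr_gt0// exprn_gt0.
have dd : wdominated G (fun w => mart w y0 ^+ 2 - mart w z ^+ 2).
  rewrite (_ : (fun w => _) = fun w => 1 * mart w y0 ^+ 2 + (-1) * mart w z ^+ 2).
    exact: wdominated_lin.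
  by apply/funext => w; ring.
have -> : second_moment (m ^ 2) y0 - second_moment (m ^ 2) z =
    wordmean p (m ^ 2) (fun w => mart w y0 ^+ 2 - mart w z ^+ 2).
  rewrite -[second_moment _ y0]mul1r -[second_moment _ z]mul1r -mulNr -wlin//.
  by congr wordmean; apply/funext => w; ring.
apply: le_trans (wordmean_norm p_ge0 G_ge1 pG_cvg _ dd) _.
(* [F1] dominates the absolute difference of the martingales because that difference is at least
   [- c0]; both being centred, its expectation is exactly [2 * c0]. *)
pose F1 w := 1 * (1 * mart w y0 + (-1) * mart w z) + 2 * c0 * 1.
pose F2 w := 1 * mart w y0 ^+ 4 + 1 * mart w z ^+ 4.
have dF1 : wdominated G F1 by do 2 ?[apply: wdominated_lin => //].
have dF2 : wdominated G F2 by exact: wdominated_lin.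
apply: (@le_trans _ _ (wordmean p (m ^ 2) (fun w => K * F1 w + 8 / K ^+ 2 * F2 w))).
  apply: wle; [exact: wdominated_norm|exact: wdominated_lin|move=> w].
  rewrite /F1 /F2; have := Hy0 w z; move: (mart w y0) (mart w z) => a c ac.
  rewrite subr_sqr normrM !mul1r mulN1r mulr1.
  have l1 : `|a - c| <= a - c + 2 * c0.
    by rewrite ler_norml; apply/andP; split; lra.
  have l2 : `|a - c| <= `|a| + `|c| by rewrite ler_normB.
  have l3 : `|a + c| <= `|a| + `|c| by rewrite ler_normD.
  set S := `|a| + `|c| in l2 l3.
  have S0 : 0 <= S by rewrite addr_ge0.
  have S4 : S ^+ 4 <= 8 * (a ^+ 4 + c ^+ 4).
    have -> : a ^+ 4 = `|a| ^+ 4 by rewrite -normrX ger0_norm// exprn_even_ge0.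
    have -> : c ^+ 4 = `|c| ^+ 4 by rewrite -normrX ger0_norm// exprn_even_ge0.
    rewrite /S -subr_ge0; move: `|a| `|c| => x z'.
    rewrite (_ : _ - _ = (x - z') ^+ 2 * (5 * (x + z') ^+ 2 + 2 * x ^+ 2 + 2 * z' ^+ 2)).
      by rewrite !(sqr_ge0, mulr_ge0, addr_ge0).
    by ring.
  have q0 : 0 <= 8 / K ^+ 2 * (a ^+ 4 + c ^+ 4).
    by rewrite mulr_ge0 ?divr_ge0 ?sqr_ge0// addr_ge0// exprn_even_ge0.
  (* Below the level, one factor of the difference of squares is at most [K] and the other is
     bounded in L^1. Above it, [S ^+ 2 <= S ^+ 4 / K ^+ 2] brings in the fourth moments. *)
  have [SK|KS] := leP S K.
    rewrite (@le_trans _ _ (K * (a - c + 2 * c0)))// ?lerDl//.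
    by rewrite mulrC ler_pM// (le_trans l3).
  rewrite (@le_trans _ _ (8 / K ^+ 2 * (a ^+ 4 + c ^+ 4)))//; last first.
    by rewrite lerDr mulr_ge0// ?(ltW K0)// (le_trans _ l1).
  apply: (@le_trans _ _ (S ^+ 2)); first by rewrite expr2 ler_pM.
  rewrite mulrAC ler_pdivlMr ?exprn_gt0//; apply: le_trans S4.
  rewrite (exprD S 2 2) ler_wpM2l ?sqr_ge0// lerXn2r ?nnegrE// ltW//.
rewrite wlin//.
have -> : wordmean p (m ^ 2) F1 = 2 * c0.
  rewrite /F1 wlin//; last exact: wdominated_lin.
  by rewrite wlin// !wordmean_mart wordmean_cst//; ring.
have W2 : wordmean p (m ^ 2) F2 <= 2 * C * m%:R ^+ 4.
  rewrite /F2 wlin// !mul1r (le_trans (lerD (HC m y0 m1 m_a) (HC m z m1 m_a)))//.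
  by rewrite le_eqVlt; apply/orP; left; apply/eqP; ring.
apply: (@le_trans _ _ (K * (2 * c0) + 8 / K ^+ 2 * (2 * C * m%:R ^+ 4))).
  by rewrite lerD2l ler_wpM2l// divr_ge0// exprn_ge0// ltW.
have -> : 8 / K ^+ 2 * (2 * C * m%:R ^+ 4) = B.
  by rewrite /K /B; field; rewrite !gt_eqF.
have h1 : K * (2 * c0) <= e / 4 * m%:R ^+ 2.
  rewrite /K mulrAC ler_wpM2r ?sqr_ge0// /del mulrAC ler_pdivrMr; last first.
    by rewrite mulr_gt0// ltr_wpDl.
  by nra.
have h2 : B <= e / 4 * m%:R ^+ 2.
  move: m_e; rewrite ler_pdivrMr// => m_e.
  have : m%:R * e <= m%:R ^+ 2 * e.
    by rewrite ler_wpM2r ?(ltW e0)// expr2 ler_peMr// ltW.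
  by lra.
by rewrite natrX; lra.
Qed.
Lemma second_moment_ge0 n y : 0 <= second_moment n y.
Proof.
by rewrite -[X in X <= _](wordmean_cst p_sum1 n 0); apply: wle => // w; exact: sqr_ge0.
Qed.

Lemma step_var_cvg y : cvgn (series (fun k => p k * f k y ^+ 2)).
Proof. exact: (dominated_cvg p_ge0 G_ge1 pG_cvg (d_expn 2 y)). Qed.

Lemma second_moment_cvg n y : cvgn (series (fun k => p k * second_moment n (T k y))).
Proof.
exact: (dominated_cvg p_ge0 G_ge1 pG_cvg (d_bounded y (second_moment_bound n))).
Qed.

Lemma tilted_cvg (u : Y -> R) (U s lam : R) y : (forall y, `|u y| <= U) ->
  `|lam| <= alpha ->
  cvgn (series (fun k =>
    p k * expR (lam * f k y + lam ^+ 2 / 2 * (u (T k y) - u y - s)))).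
Proof.
move=> uU lama; apply: (dominated_cvg p_ge0 G_ge1 pG_cvg).
exists (expR (lam ^+ 2 / 2 * (U + U + `|s|))) => k.
rewrite ger0_norm ?expR_ge0// -expRD ler_expR addrC lerD//.
  rewrite ler_wpM2l ?divr_ge0 ?sqr_ge0//.
  have := uU y; have := uU (T k y); rewrite !ler_norml => /andP[_ h1] /andP[h2 _].
  by have := ler_norm (- s); rewrite normrN; lra.
by rewrite (le_trans (ler_norm _))// normrM ler_pM.
Qed.

(** * The corrector [u] of the overview and the tilted one-step mean *)

Definition corrector (N : nat) (y : Y) : R :=
  N%:R^-1 * \sum_(n < N) second_moment n y.

Let d_second_moment n y : dominated G (fun k => second_moment n (T k y)).
Proof. exact: d_bounded (second_moment_bound n). Qed.

Lemma corrector_bounded N : exists U, forall y, `|corrector N y| <= U.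
Proof.
exists (N%:R^-1 * \sum_(n < N) 2 / alpha ^+ 2 * mean p G ^+ n) => y.
rewrite /corrector normrM ger0_norm ?invr_ge0// ler_wpM2l ?invr_ge0//.
apply: le_trans (ler_norm_sum _ _ _) _; apply: ler_sum => n _.
exact: second_moment_bound.
Qed.

(** Summing [second_momentS] over times below [N] telescopes, starting from a zero second moment at
    time 0. *)
Lemma corrector_eq N y : (0 < N)%N ->
  step_var y + mean p (fun k => corrector N (T k y)) - corrector N y =
  second_moment N y / N%:R.
Proof.
move=> N0; have N0' : N%:R != 0 :> R by rewrite pnatr_eq0 -lt0n.
have E n : dominated G (fun k => \sum_(i < n) second_moment i (T k y)) /\
    mean p (fun k => \sum_(i < n) second_moment i (T k y)) =
    \sum_(i < n) second_moment i y + second_moment n y - n%:R * step_var y.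
  elim: n => [|n [IHd IHm]].
    have -> : (fun k => \sum_(i < 0) second_moment i (T k y)) = fun=> 0.
      by apply/funext => k; rewrite big_ord0.
    rewrite mean_cst// big_ord0 mul0r subr0 add0r /second_moment /= expr0n.
    by split => //; exact: dcst.
  have -> : (fun k => \sum_(i < n.+1) second_moment i (T k y)) =
      (fun k => 1 * \sum_(i < n) second_moment i (T k y) + 1 * second_moment n (T k y)).
    by apply/funext => k; rewrite big_ord_recr/= !mul1r.
  split; first exact: dominated_lin.
  rewrite mlin// IHm big_ord_recr/= second_momentS -natr1; ring.
have [Ed Em] := E N.
rewrite /corrector (meanZ p_ge0 G_ge1 pG_cvg)// Em; by field.
Qed.

Lemma tilted_mean_expand (u : Y -> R) (U s : R) : (forall y, `|u y| <= U) ->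
  exists2 C, 0 <= C & forall y lam, `|lam| <= 1 -> `|lam| <= alpha / 2 ->
    `|mean p (fun k => expR (lam * f k y + lam ^+ 2 / 2 * (u (T k y) - u y - s)))
      - (1 + lam ^+ 2 / 2 * (step_var y + mean p (fun k => u (T k y)) - u y - s))|
    <= C * `|lam| ^+ 3.
Proof.
move=> uU; pose D := `|U| + `|s|.
have D0 : 0 <= D by rewrite addr_ge0.
have [C C0 HC] := mean_expand D0; exists C => // y lam lam1 lama.
(* Half of [u (T k y) - u y - s], written as a linear combination so that its mean can be
   computed. *)
pose h k := 2^-1 * (u (T k y)) + (- (2^-1) * (u y + s)) * 1.
have hD k : `|h k| <= D.
  rewrite (_ : h k = 2^-1 * (u (T k y) - u y - s)); last by rewrite /h; ring.
  rewrite normrM ger0_norm ?invr_ge0// mulrC ler_pdivrMr//.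
  have := ler_normB (u (T k y) - u y) s; have := ler_normB (u (T k y)) (u y).
  have := uU y; have := uU (T k y); have := ler_norm U; have := normr_ge0 s.
  rewrite /D; lra.
have := HC h y lam hD lam1 lama.
rewrite /h mlin//; last exact: d_bounded uU.
rewrite mean_cst//.
congr (`|_ - _| <= _).
  by congr mean; apply/funext => k; congr expR; field.
by field.
Qed.

(** This fixes the radius in the next two lemmas: there the cubic error is no larger than the
    quadratic slack [lam ^+ 2 * eta / 2]. *)
Let cube_le (C eta lam : R) : 0 <= C -> `|lam| <= eta / (2 * (C + 1)) ->
  C * `|lam| ^+ 3 <= lam ^+ 2 * (eta / 2).
Proof.
move=> C0; rewrite ler_pdivlMr ?mulr_gt0 ?ltr_wpDl// => lame.
have -> : C * `|lam| ^+ 3 = lam ^+ 2 * (C * `|lam|).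
  by rewrite exprSr -normrX (ger0_norm (sqr_ge0 lam)); ring.
rewrite ler_wpM2l ?sqr_ge0//.
apply: (@le_trans _ _ ((C + 1) * `|lam|)); first by rewrite ler_wpM2r// lerDl.
by rewrite ler_pdivlMr// (_ : _ * 2 = `|lam| * (2 * (C + 1)))//; ring.
Qed.

(** The margin [eta] yields a quadratic slack that swallows the cubic error of [tilted_mean_expand],
    with a radius independent of [y]. *)
Lemma tilted_mean_le1 (u : Y -> R) (U s eta : R) : (forall y, `|u y| <= U) ->
  0 < eta ->
  (forall y, step_var y + mean p (fun k => u (T k y)) - u y <= s - eta) ->
  exists2 del, 0 < del & forall lam y, `|lam| <= del ->
    mean p (fun k => expR (lam * f k y + lam ^+ 2 / 2 * (u (T k y) - u y - s)))
    <= 1.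
Proof.
move=> uU eta0 Hs; have [C C0 HC] := tilted_mean_expand s uU.
exists (Num.min 1 (Num.min (alpha / 2) (eta / (2 * (C + 1))))).
  by rewrite !lt_min ltr01 !divr_gt0// mulr_gt0// ltr_wpDl.
move=> lam y; rewrite !le_min => /and3P[lam1 lama lame].
have := le_trans (ler_norm _) (HC y lam lam1 lama); rewrite lerBlDr => /le_trans.
apply; rewrite addrCA gerDl.
have h := cube_le C0 lame; rewrite -mulrA.
apply: (@le_trans _ _ (lam ^+ 2 * (eta / 2) + lam ^+ 2 * (2^-1 * (- eta)))).
  rewrite lerD// !ler_wpM2l ?sqr_ge0// ?invr_ge0//; have := Hs y.
  by move: (step_var y) (mean _ _) (u y) => *; lra.
by rewrite -mulrDr mulrN (mulrC eta) subrr mulr0.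
Qed.

Lemma tilted_mean_ge1 (u : Y -> R) (U s eta : R) : (forall y, `|u y| <= U) ->
  0 < eta ->
  (forall y, s + eta <= step_var y + mean p (fun k => u (T k y)) - u y) ->
  exists2 del, 0 < del & forall lam y, `|lam| <= del ->
    1 <=
    mean p (fun k => expR (lam * f k y + lam ^+ 2 / 2 * (u (T k y) - u y - s))).
Proof.
move=> uU eta0 Hs; have [C C0 HC] := tilted_mean_expand s uU.
exists (Num.min 1 (Num.min (alpha / 2) (eta / (2 * (C + 1))))).
  by rewrite !lt_min ltr01 !divr_gt0// mulr_gt0// ltr_wpDl.
move=> lam y; rewrite !le_min => /and3P[lam1 lama lame].
have := HC y lam lam1 lama; rewrite ler_norml => /andP[+ _].
rewrite lerBrDr; apply: le_trans; rewrite addrCA lerDl.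
have h := cube_le C0 lame; rewrite -mulrA addrC subr_ge0.
apply: le_trans h _.
rewrite ler_wpM2l ?sqr_ge0// mulrC ler_wpM2l ?invr_ge0//; have := Hs y.
by move: (step_var y) (mean _ _) (u y) => *; lra.
Qed.

End Chain.

(** * Extended-real series, stationary measures, upper and lower limits *)

Lemma mean_EFin (R : realType) (p a : nat -> R) :
  cvgn (series (fun k => p k * a k)) ->
  (mean p a)%:E = (\sum_(k <oo) (p k * a k)%:E)%E.
Proof.
move=> c; rewrite /mean -EFin_lim//; congr (limn _); apply/funext => n /=.
by rewrite sumEFin.
Qed.

(** Stationarity says that [nu] is the countable mixture of its images under the [T k] with weights
    [p k]; one integrates against that mixture. *)
Lemma stationary_integral (R : realType) dY (Y : measurableType dY)
  (nu : {measure set Y -> \bar R}) (T : nat -> Y -> Y) (p : nat -> R) (u : Y -> R) :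
  (forall k, 0 <= p k) -> (forall k, measurable_fun setT (T k)) ->
  (forall A, measurable A ->
    nu A = \sum_(k <oo) ((p k)%:E * nu (T k @^-1` A)))%E ->
  measurable_fun setT u -> (forall y, 0 <= u y) ->
  (\int[nu]_y (u y)%:E = \sum_(k <oo) ((p k)%:E * \int[nu]_y (u (T k y))%:E))%E.
Proof.
move=> p0 mT st mu u0.
pose m_ k : {measure set Y -> \bar R} :=
  mscale (NngNum (p0 k)) (pushforward nu (T k)).
have mE : measurable_fun setT (EFin \o u) by exact/measurable_EFinP.
transitivity (\int[mseries (m_ mT) 0]_y (u y)%:E)%E.
  by apply: eq_measure_integral => A mA _; rewrite st.
rewrite ge0_integral_measure_series//; last by move=> y _; rewrite lee_fin.
apply: eq_eseriesr => k _.
rewrite ge0_integral_mscale//; last by move=> y _; rewrite lee_fin.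
congr (_ * _)%E.
by rewrite ge0_integral_pushforward// => y _; rewrite lee_fin.
Qed.

Lemma measurable_mean (R : realType) dY (Y : measurableType dY) (p : nat -> R)
  (a : nat -> Y -> R) :
  (forall k, measurable_fun setT (a k)) ->
  (forall y, cvgn (series (fun k => p k * a k y))) ->
  measurable_fun setT (fun y => mean p (a^~ y)).
Proof.
move=> ma ca; apply: (measurable_fun_cvg
  (h := fun n y => series (fun k => p k * a k y) n)) => [n|y _]; last exact: ca.
by apply: measurable_sum => k; exact: measurable_funM.
Qed.

Lemma nneseries1_cvg (R : realType) (p : nat -> R) : (forall k, 0 <= p k) ->
  (\sum_(n <oo) (p n)%:E = 1)%E -> series p @ \oo --> (1 : R).
Proof.
move=> p0 p1; have c : cvgn (series p).
  by apply: nnseries_is_cvg => //; rewrite p1 ltry.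
suff <- : limn (series p) = 1 by [].
apply: EFin_inj; rewrite -p1 -EFin_lim//; congr (limn _); apply/funext => n /=.
by rewrite sumEFin.
Qed.

Lemma limn_esup_le_near (R : realType) (u : (\bar R)^nat) (l c : R) :
  (forall n, (0 < n)%N -> u n <= (l + c / n%:R)%:E)%E ->
  (limn_esup u <= l%:E)%E.
Proof.
move=> ul; apply/lee_addgt0Pr => e e0.
have [N Nc] : exists N : nat, forall n, (N <= n)%N -> (0 < n)%N /\ c / n%:R <= e.
  exists (Num.truncn (`|c| / e)).+1 => n Nn; split; first exact: leq_trans Nn.
  have n0 : 0 < n%:R :> R by rewrite ltr0n (leq_trans _ Nn).
  rewrite ler_pdivrMr// (le_trans (ler_norm c))// mulrC -ler_pdivrMr//.
  by rewrite ltW// (lt_le_trans (truncnS_gt _))// ler_nat.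
rewrite /limn_esup /limf_esup.
(* The upper limit is an infimum over the sets of the filter, so a single tail suffices. *)
apply: (@le_trans _ _ (ereal_sup (u @` [set n | (N <= n)%N]))).
  by apply: ereal_inf_lbound; exists [set n | (N <= n)%N] => //; exists N.
apply: ge_ereal_sup => _ [n /= Nn <-]; have [n0 cn] := Nc n Nn.
by rewrite (le_trans (ul n n0))// -EFinD lee_fin lerD2l.
Qed.

Lemma limn_einf_ge_near (R : realType) (u : (\bar R)^nat) (l c : R) :
  (forall n, (0 < n)%N -> (l - c / n%:R)%:E <= u n)%E ->
  (l%:E <= limn_einf u)%E.
Proof.
move=> ul; rewrite /limn_einf leeNr -EFinN.
apply: (@limn_esup_le_near _ _ _ c) => n n0.
by rewrite leeNl -EFinN opprD opprK; exact: ul.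
Qed.

(** One inequality is proved for every nonnegative scalar; used with [c^-1] it yields the
    converse. *)
Lemma esumZ (R : realType) (S : choiceType) (A : set S) (c : R) (a : S -> \bar R) :
  0 <= c -> (forall i, A i -> 0 <= a i)%E ->
  (\esum_(i in A) (c%:E * a i) = c%:E * \esum_(i in A) a i)%E.
Proof.
have le (k : R) (b : S -> \bar R) : 0 <= k -> (forall i, A i -> 0 <= b i)%E ->
    (\esum_(i in A) (k%:E * b i) <= k%:E * \esum_(i in A) b i)%E.
  move=> k0 b0; apply: ge_ereal_sup => _ [F [finF FA] <-].
  rewrite !fsbig_finite//= big_seq -ge0_sume_distrr; last first.
    by move=> i; rewrite in_fset_set// inE => /FA/b0.
  apply: lee_wpmul2l; rewrite ?lee_fin// -big_seq -fsbig_finite//=.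
  by apply: ereal_sup_ubound; exists F.
move=> c0 a0; apply/le_anti; rewrite le//=.
have [->|cN0] := eqVneq c 0.
  by rewrite mul0e esum1// => i _; rewrite mul0e.
have ci0 : 0 <= c^-1 by rewrite invr_ge0.
have cK z : (c^-1%:E * (c%:E * z) = z)%E by rewrite muleA -EFinM mulVf// mul1e.
have cV z : (c%:E * (c^-1%:E * z) = z)%E by rewrite muleA -EFinM divff// mul1e.
rewrite -[leRHS]cV lee_wpmul2l ?lee_fin//.
rewrite -[X in (X <= _)%E](_ : \esum_(i in A) (c^-1%:E * (c%:E * a i)) = _)%E.
  by apply: le => // i Ai; rewrite mule_ge0 ?a0// lee_fin.
by apply: eq_esum => i _; rewrite cK.
Qed.

(** * Size of horofunctions and of the Busemann cocycle *)

Section Horofunctions.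
Variables (R : realType) (X : Type) (d : X -> X -> R) (o : X).
Hypothesis d_metric : is_metric d.

(** For [hfun d o x] this is the triangle inequality; approximation at the single point [m] carries
    it to the closure. *)
Lemma hval_le (h : horoT d o) m : `|hval h m| <= d m o.
Proof.
have [_ _ dC dT] := d_metric.
apply/ler_addgt0Pr => e e0.
have [x /(_ ord0) hx] := proj2_sig h 1%N (fun=> m) e e0.
have hm : `|hfun d o x m| <= d m o.
  have := dT x o m; have := dT x m o; rewrite (dC o m) => h1 h2.
  by rewrite /hfun ler_norml; apply/andP; split; lra.
rewrite -(subrK (hfun d o x m) (hval h m)).
by rewrite (le_trans (ler_normD _ _))// addrC lerD// ltW.
Qed.

Lemma hval_base (h : horoT d o) : hval h o = 0.
Proof.
by have [d0 _ _ _] := d_metric; apply/normr0_eq0/le_anti; rewrite normr_ge0 -(d0 o) hval_le.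
Qed.

Lemma busemann_le (a : isom d) (h : horoT d o) : `|busemann o a h| <= kappa o a.
Proof.
have [_ _ dC _] := d_metric; apply: le_trans (hval_le _ _) _.
by rewrite /kappa dC -{1}(iisoP a) iinvK.
Qed.

End Horofunctions.

(** * Measurability of the action, and recursion for the moment generating function *)

Section Words.
Variables (R : realType) (X : Type) (d : X -> X -> R) (o : X).
Variable g : nat -> isom d.

Lemma measurable_hval m : measurable_fun setT (fun h : horoT d o => hval h m).
Proof.
move=> _ B mB; rewrite setTI; apply: sub_sigma_algebra.
by exists m => //; exists B.
Qed.

Lemma measurable_act (a : isom d) : measurable_fun setT (act o a).
Proof.
apply: (@measurability _ _ (horoT d o) (horoT d o) setT (act o a) (@horo_gen R X d o)) => //.
move=> _ [_ [m _ [B mB <-]] <-]; rewrite setTI.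
have : measurable_fun setT
    (fun h : horoT d o => hval h (Defs.iinv a m) - hval h (Defs.iinv a o)).
  by apply: measurable_funB; exact: measurable_hval.
by move=> /(_ measurableT B mB); rewrite setTI.
Qed.

Definition winv_o (w : seq nat) : X := foldr (fun i acc => Defs.iinv (g i) acc) o w.

Lemma word_inv_oE n (w : {ffun 'I_n -> nat}) :
  word_inv_o o g w = winv_o [seq w i | i <- enum 'I_n].
Proof. by rewrite /word_inv_o /winv_o foldr_map. Qed.

(** The cocycle identity for the Busemann cocycle: the head [k] is [X_1], which acts first on
    [x]. *)
Lemma hval_winv_cons (k : nat) w (x : horoT d o) :
  hval x (winv_o (k :: w)) = busemann o (g k) x + hval (act o (g k) x) (winv_o w).
Proof. by rewrite /busemann /= /act_fun addrC subrK. Qed.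

Variable p : nat -> R.
Hypothesis p_ge0 : forall k, 0 <= p k.

Definition ffun_cons n (kw : nat * {ffun 'I_n -> nat}) : {ffun 'I_n.+1 -> nat} :=
  [ffun i => if unlift ord0 i is Some j then kw.2 j else kw.1].

Lemma ffun_cons_bij n : bijective (@ffun_cons n).
Proof.
exists (fun w : {ffun 'I_n.+1 -> nat} =>
  (w ord0, [ffun j => w (lift ord0 j)] : {ffun 'I_n -> nat})).
- move=> [k w]; rewrite /ffun_cons ffunE unlift_none; congr pair.
  by apply/ffunP => j; rewrite !ffunE liftK.
- move=> w; apply/ffunP => i; rewrite ffunE /=.
  by case: unliftP => [j ->|->]; rewrite ?ffunE.
Qed.

Lemma mgf0 (x : horoT d o) lam : hval x o = 0 -> mgf o p g x lam 0 = 1%E.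
Proof.
move=> xo; rewrite /mgf (_ : [set: {ffun 'I_0 -> nat}] = [set [ffun=> 0%N]]).
  rewrite esum_set1; last by rewrite lee_fin mulr_ge0 ?expR_ge0// prodr_ge0.
  by rewrite big_ord0 /word_inv_o enum_ord0 /= xo mulr0 expR0 mulr1.
by apply/seteqP; split => // w _ /=; apply/ffunP => -[].
Qed.

(** Words of length [n.+1] are reindexed by head and tail, and the cocycle identity factors each
    summand. *)
Lemma mgfS (x : horoT d o) lam n : mgf o p g x lam n.+1 =
  (\sum_(k <oo) ((p k * expR (lam * busemann o (g k) x))%:E *
     mgf o p g (act o (g k) x) lam n))%E.
Proof.
rewrite nneseries_esumT; last first.
  move=> k; rewrite mule_ge0 ?lee_fin ?mulr_ge0 ?expR_ge0//.
  by apply: esum_ge0 => w _; rewrite lee_fin mulr_ge0 ?expR_ge0// prodr_ge0.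
have E k w : ((\prod_(i < n.+1) p (ffun_cons (k, w) i)) *
      expR (lam * hval x (word_inv_o o g (ffun_cons (k, w)))))%:E =
    ((p k * expR (lam * busemann o (g k) x))%:E *
     ((\prod_(i < n) p (w i)) *
      expR (lam * hval (act o (g k) x) (word_inv_o o g w)))%:E)%E.
  rewrite -EFinM; congr EFin; rewrite big_ord_recl /ffun_cons ffunE unlift_none /=.
  rewrite (eq_bigr (fun i => p (w i))); last first.
    by move=> i _; rewrite ffunE liftK.
  rewrite !word_inv_oE enum_ordSl /= ffunE unlift_none -map_comp.
  rewrite (eq_map (g := w)); last by move=> i /=; rewrite ffunE liftK.
  by rewrite hval_winv_cons mulrDr expRD; ring.
transitivity (\esum_(k in [set: nat]) \esum_(w in [set: {ffun 'I_n -> nat}])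
    ((p k * expR (lam * busemann o (g k) x))%:E *
     ((\prod_(i < n) p (w i)) *
      expR (lam * hval (act o (g k) x) (word_inv_o o g w)))%:E)%E).
  rewrite esum_esum; last first.
    move=> k w _ _; rewrite mule_ge0 ?lee_fin ?mulr_ge0 ?expR_ge0//.
    by rewrite prodr_ge0.
  rewrite /mgf (reindex_esum [set: nat * {ffun 'I_n -> nat}] _
    (@ffun_cons n)); last first.
    by rewrite setTT_bijective; exact: ffun_cons_bij.
  rewrite (_ : setT `*`` _ = setT); last by apply/seteqP; split.
  by apply: eq_esum => -[k w] _; rewrite E.
apply: eq_esum => k _; rewrite /mgf esumZ ?mulr_ge0 ?expR_ge0// => w _.
by rewrite lee_fin mulr_ge0 ?expR_ge0// prodr_ge0.
Qed.

End Words.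

(** * Logarithmic bounds and limits at zero in the extended reals *)

Lemma eln_bounds (R : realType) (y : \bar R) (a b : R) :
  ((expR a)%:E <= y)%E -> (y <= (expR b)%:E)%E ->
  (a%:E <= eln y)%E /\ (eln y <= b%:E)%E.
Proof.
case: y => [r| |] //=; rewrite !lee_fin => ar rb.
(* The lower bound keeps [r] in the range where [ln] is monotone, away from its default value. *)
have r0 : 0 < r by rewrite (lt_le_trans _ ar)// expR_gt0.
by rewrite -(expRK a) -(expRK b) !ler_ln ?posrE ?expR_gt0.
Qed.

Lemma near_dnbhs0 (R : realType) (P : R -> Prop) (del : R) : 0 < del ->
  (forall lam, `|lam| <= del -> lam != 0 -> P lam) ->
  \forall lam \near (0 : R)^', P lam.
Proof.
move=> del0 H; apply/nbhs_ballP; exists del => //= lam.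
rewrite /ball/= sub0r normrN => /ltW lamd lam0; exact: H.
Qed.

Lemma cvge_between (R : realType) (F : R -> \bar R) (l : R) :
  (forall e, 0 < e -> \forall lam \near (0 : R)^',
     ((l - e)%:E <= F lam)%E /\ (F lam <= (l + e)%:E)%E) ->
  F @ (0 : R)^' --> l%:E.
Proof.
move=> H; apply/fine_cvgP; split.
  apply: filterS (H 1 ltr01) => lam [h1 h2].
  by rewrite fin_numElt (lt_le_trans _ h1) ?ltNyr// (le_lt_trans h2) ?ltry.
apply/cvgrPdist_le => e e0; apply: filterS (H e e0) => lam /=.
case: (F lam) => [r| |] [] //=; rewrite !lee_fin => h1 h2.
by rewrite ler_distlC h1 h2.
Qed.

(** * Sub- and super-eigenfunctions of the tilted operator *)

Section Mgf.
Variables (R : realType) (X : Type) (d : X -> X -> R) (o : X).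
Variables (g : nat -> isom d) (p : nat -> R).
Hypothesis d_metric : is_metric d.
Hypothesis p_ge0 : forall k, 0 <= p k.
Variables (H : horoT d o -> R) (lam beta c : R).
Hypothesis H_le : forall y, `|H y| <= c.
(** The mean of [expR (t k y)] over [k] is the tilted operator applied to [expR H] at [y], divided
    by [expR (beta + H y)]. Comparing it with 1 says whether [expR H] is a super- or a
    sub-eigenfunction for [expR beta]. *)
Let t k y := lam * busemann o (g k) y + H (act o (g k) y) - H y - beta.
Hypothesis t_cvg : forall y, cvgn (series (fun k => p k * expR (t k y))).

Let termE (c' : R) n k x : ((p k * expR (lam * busemann o (g k) x))%:E *
    (expR (H (act o (g k) x) + n%:R * beta + c'))%:E =
  (expR (H x + n.+1%:R * beta + c'))%:E * (p k * expR (t k x))%:E)%E.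
Proof.
rewrite -!EFinM; congr EFin.
rewrite -mulrA -expRD mulrCA -expRD; congr (_ * expR _).
by rewrite /t -natr1; ring.
Qed.

Let pe_ge0 k (e : R) : 0 <= p k * expR e.
Proof. by rewrite mulr_ge0// expR_ge0. Qed.

Let mgf_ge0 x n : (0 <= mgf o p g x lam n)%E.
Proof. by apply: esum_ge0 => w _; rewrite lee_fin mulr_ge0 ?expR_ge0// prodr_ge0. Qed.

(** The eigenfunction inequality is iterated; [c] pays for replacing the initial value 1 by
    [expR H]. *)
Lemma mgf_le : (forall y, mean p (fun k => expR (t k y)) <= 1) ->
  forall n x, (mgf o p g x lam n <= (expR (H x + n%:R * beta + c))%:E)%E.
Proof.
move=> t1; elim=> [|n IH] x.
  rewrite mgf0 ?hval_base// lee_fin -[leLHS]expR0 ler_expR mul0r addr0.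
  by have := H_le x; rewrite ler_norml => /andP[h _]; lra.
rewrite mgfS//.
apply: (@le_trans _ _ (\sum_(k <oo) ((expR (H x + n.+1%:R * beta + c))%:E *
    (p k * expR (t k x))%:E))%E).
  apply: lee_nneseries => [k _ _|k _]; first by rewrite mule_ge0// lee_fin.
  by rewrite -termE lee_wpmul2l// lee_fin.
rewrite nneseriesZl; last by move=> k _; rewrite lee_fin.
rewrite -mean_EFin// -EFinM lee_fin -[leRHS]mulr1.
by rewrite ler_wpM2l ?expR_ge0.
Qed.

Lemma mgf_ge : (forall y, 1 <= mean p (fun k => expR (t k y))) ->
  forall n x, ((expR (H x + n%:R * beta - c))%:E <= mgf o p g x lam n)%E.
Proof.
move=> t1; elim=> [|n IH] x.
  rewrite mgf0 ?hval_base// lee_fin -[leRHS]expR0 ler_expR mul0r addr0.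
  by have := H_le x; rewrite ler_norml => /andP[_ h]; lra.
rewrite mgfS//.
apply: (@le_trans _ _ (\sum_(k <oo) ((expR (H x + n.+1%:R * beta - c))%:E *
    (p k * expR (t k x))%:E))%E); last first.
  apply: lee_nneseries => [k _ _|k _]; first by rewrite mule_ge0// lee_fin ?expR_ge0.
  by rewrite -termE lee_wpmul2l// lee_fin.
rewrite nneseriesZl; last by move=> k _; rewrite lee_fin.
rewrite -mean_EFin// -EFinM lee_fin -[leLHS]mulr1.
by rewrite ler_wpM2l ?expR_ge0.
Qed.

End Mgf.

(** * The random walk on the horofunction compactification *)

Section Walk.
Variables (R : realType) (X : Type) (d : X -> X -> R) (o : X).
Variables (g : nat -> isom d) (p : nat -> R) (alpha ell M : R).
Variables (psi : horoT d o -> R) (nu : probability (horoT d o) R).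
Hypothesis d_metric : is_metric d.
Hypothesis p_ge0 : forall k, 0 <= p k.
Hypothesis p_sum1 : series p @ \oo --> (1 : R).
Hypothesis alpha_gt0 : 0 < alpha.
Hypothesis exp_moment :
  (\sum_(n <oo) (p n * expR (alpha * kappa o (g n)))%:E < +oo)%E.
Hypothesis psi_meas : measurable_fun [set: horoT d o] psi.
Hypothesis psi_le : forall x, `|psi x| <= M.
Hypothesis psi_cvg : forall x : horoT d o, (fun N : nat => \sum_(0 <= n < N)
  p n * (busemann o (g n) x + psi (act o (g n) x) - psi x)) @ \oo --> ell.
Hypothesis nu_stat : forall A : set (horoT d o), measurable A ->
  nu A = (\sum_(n <oo) ((p n)%:E * nu (act o (g n) @^-1` A)))%E.

Let T k := act o (g k).
Let f k y := busemann o (g k) y + psi (act o (g k) y) - psi y - ell.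
Let b k := kappa o (g k) + (2 * M + `|ell|).

Let M_ge0 : 0 <= M.
Proof. exact: le_trans (normr_ge0 _) (psi_le point). Qed.

Let kappa_ge0 k : 0 <= kappa o (g k).
Proof. exact: le_trans (normr_ge0 _) (busemann_le d_metric (g k) point). Qed.

Let b_ge0 k : 0 <= b k.
Proof. by rewrite addr_ge0// addr_ge0// mulr_ge0. Qed.

Let f_le k y : `|f k y| <= b k.
Proof.
have := busemann_le d_metric (g k) y; have := psi_le y; have := psi_le (T k y).
have := ler_norm ell; have := ler_norm (- ell); rewrite normrN /f /b /T.
rewrite !ler_norml => h1 h2 /andP[h3 h4] /andP[h5 h6] /andP[h7 h8].
by apply/andP; split; lra.
Qed.

Let pG_cvg : cvgn (series (fun k => p k * expR (alpha * b k))).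
Proof.
have c : cvgn (series (fun k => p k * expR (alpha * kappa o (g k)))).
  by apply: nnseries_is_cvg => // k; rewrite mulr_ge0// expR_ge0.
have -> : (fun k => p k * expR (alpha * b k)) =
    expR (alpha * (2 * M + `|ell|)) *: (fun k => p k * expR (alpha * kappa o (g k))).
  apply/funext => k; rewrite /b mulrDr expRD.
  by rewrite mulrA mulrC.
exact: is_cvg_seriesZ.
Qed.

Let mean_f y : mean p (f^~ y) = 0.
Proof.
apply: mean_cvg.
have -> : (0 : R) = ell - 1 * ell by rewrite mul1r subrr.
have -> : series (fun k => p k * f k y) = fun N =>
    \sum_(0 <= n < N) p n * (busemann o (g n) y + psi (act o (g n) y) - psi y) -
    series p N * ell.
  apply/funext => N; rewrite /series/= mulr_suml -sumrB.
  by apply: eq_bigr => k _; rewrite /f; ring.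
by apply: cvgB; [exact: psi_cvg|apply: cvgMr_tmp].
Qed.

Let ov := step_var f p.
Let V := second_moment T f p.

(** The [psi] terms telescope along the orbit, which identifies [mart] with
    [sigma_0(L_n, y) - n ell]. *)
Lemma mart_hval w y : mart T f w y = hval y (winv_o o g w) -
  (size w)%:R * ell + psi (foldl (fun z k => T k z) y w) - psi y.
Proof.
elim: w y => [|k w IH] y; first by rewrite /= hval_base//; ring.
rewrite hval_winv_cons [LHS]/= IH [size _]/= [foldl _ _ (_ :: _)]/= -natr1 /f /T.
by ring.
Qed.

(* [h_o] maximizes [h |-> sigma(L_n, h)], with maximum [kappa(L_n)]. *)
Lemma mart_le_base w y :
  mart T f w y - 4 * M <= mart T f w (exist _ (hfun d o o) (is_horo_hfun d o o)).
Proof.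
have [d0 _ dC _] := d_metric; rewrite !mart_hval.
set y0 := exist _ _ _; set z := winv_o o g w.
(* At the base horofunction the bound [hval_le] is an equality; the four remaining [psi] values
   account for [4 * M]. *)
have E : hval y0 z = d z o by rewrite /hval/= /hfun d0 subr0 dC.
have := hval_le d_metric y z; have := psi_le y; have := psi_le y0.
have := psi_le (foldl (fun z k => T k z) y w).
have := psi_le (foldl (fun z k => T k z) y0 w).
rewrite E !ler_norml => /andP[h1 h2] /andP[h3 h4] /andP[h5 h6] /andP[h7 h8] /andP[h9 h10].
by lra.
Qed.

Let mT k : measurable_fun setT (T k).
Proof. exact: measurable_act. Qed.

Let mf k : measurable_fun setT (f k).
Proof.
apply: measurable_funB; last exact: measurable_cst.
apply: measurable_funB => //; apply: measurable_funD; first exact: measurable_hval.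
exact: (measurableT_comp psi_meas (mT k)).
Qed.

Lemma measurable_step_var : measurable_fun setT ov.
Proof.
apply: measurable_mean => [k|y]; first exact: measurable_funX.
exact: (step_var_cvg p_ge0 alpha_gt0 b_ge0 f_le pG_cvg).
Qed.

Lemma measurable_second_moment n : measurable_fun setT (V n).
Proof.
elim: n => [|n IH].
  rewrite (_ : V 0%N = cst 0); first exact: measurable_cst.
  by apply/funext => y; rewrite /V /second_moment /= expr0n.
rewrite (_ : V n.+1 = fun y => ov y + mean p (fun k => V n (T k y))); last first.
  by apply/funext => y; exact: (second_momentS T p_ge0 p_sum1 alpha_gt0 b_ge0 f_le pG_cvg mean_f).
apply: measurable_funD; first exact: measurable_step_var.
apply: (measurable_mean (a := fun k y => V n (T k y))) => [k|y].
  exact: measurableT_comp.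
exact: (second_moment_cvg p_ge0 alpha_gt0 b_ge0 f_le pG_cvg).
Qed.

Let V_ge0 n y : 0 <= V n y.
Proof. exact: (second_moment_ge0 T p_ge0 p_sum1 alpha_gt0 b_ge0 f_le pG_cvg). Qed.

Let ov_ge0 y : 0 <= ov y.
Proof.
have := V_ge0 1 y.
rewrite /V (second_momentS T p_ge0 p_sum1 alpha_gt0 b_ge0 f_le pG_cvg mean_f).
by rewrite /second_moment /= expr0n /= mean_cst// addr0.
Qed.

Let sigma2 : \bar R := (\int[nu]_y (ov y)%:E)%E.

Lemma sigma2_fin : sigma2 \is a fin_num.
Proof.
set K := 2 / alpha ^+ 2 * mean p (fun k => expR (alpha * b k)).
have ovK y : ov y <= K by exact: (step_var_le p_ge0 alpha_gt0 b_ge0 f_le pG_cvg).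
have s0 : (0 <= sigma2)%E by apply: integral_ge0 => y _; rewrite lee_fin.
have sK : (sigma2 <= K%:E)%E.
  apply: (@le_trans _ _ (\int[nu]_y (cst K%:E) y)%E).
    apply: ge0_le_integral => //.
    - by move=> y _; rewrite lee_fin.
    - by apply/measurable_EFinP; exact: measurable_step_var.
    - by move=> y _; rewrite lee_fin.
  by rewrite integral_cst// [X in (_ * X)%E]probability_setT mule1.
by rewrite ge0_fin_numE// (le_lt_trans sK)// ltry.
Qed.

(** Integrating [second_momentS] against [nu], stationarity turns the integral of [P V_n] into that
    of [V_n], so each step adds [sigma2]. *)
Lemma integral_second_moment n : (\int[nu]_y (V n y)%:E = n%:R%:E * sigma2)%E.
Proof.
elim: n => [|n IH].
  rewrite mul0e; under eq_integral do rewrite /V /second_moment /= expr0n.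
  exact: integral0.
have mV k : measurable_fun setT (fun y => (p k * V n (T k y))%:E).
  apply/measurable_EFinP/measurable_funM => //.
  by apply: measurableT_comp => //; exact: measurable_second_moment.
rewrite (eq_integral (fun y =>
    (ov y)%:E + \sum_(k <oo) (p k * V n (T k y))%:E)%E); last first.
  move=> y _; rewrite -mean_EFin.
    by rewrite /V (second_momentS T p_ge0 p_sum1 alpha_gt0 b_ge0 f_le pG_cvg mean_f).
  exact: (second_moment_cvg p_ge0 alpha_gt0 b_ge0 f_le pG_cvg).
have pV k y : (0 <= (p k * V n (T k y))%:E)%E by rewrite lee_fin mulr_ge0.
rewrite ge0_integralD//; last 4 first.
- by move=> y _; rewrite lee_fin.
- by apply/measurable_EFinP; exact: measurable_step_var.
- by move=> y _; exact: nneseries_ge0.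
- exact: ge0_emeasurable_sum.
rewrite integral_nneseries//.
rewrite -natr1 EFinD ge0_muleDl ?lee_fin// mul1e addeC -IH; congr (_ + _)%E.
rewrite (stationary_integral p_ge0 mT nu_stat (measurable_second_moment n))//.
apply: eq_eseriesr => k _; rewrite -ge0_integralZl//.
- by apply/measurable_EFinP/measurableT_comp => //; exact: measurable_second_moment.
- by move=> y _; rewrite lee_fin.
- by rewrite lee_fin.
Qed.

(** The [nu]-average of [V N] is exactly [N * sigma2], and the oscillation of [V N] is at most
    [e * N], so every value is that close to the average. *)
Lemma second_moment_uniform e : 0 < e -> exists2 N, (0 < N)%N &
  forall y, `|V N y / N%:R - fine sigma2| <= e.
Proof.
move=> e0; have [|N N0 osc] := second_moment_oscillation p_ge0 p_sum1 alpha_gt0 b_ge0 f_le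
  pG_cvg mean_f _ mart_le_base e0; first by rewrite mulr_ge0.
have N0' : 0 < N%:R :> R by rewrite ltr0n.
exists N => // y.
have I := integral_second_moment N; rewrite -(fineK sigma2_fin) -EFinM in I.
have mV : measurable_fun setT (fun y => (V N y)%:E).
  by apply/measurable_EFinP; exact: measurable_second_moment.
have up : N%:R * fine sigma2 <= V N y + e * N%:R.
  rewrite -lee_fin -I.
  apply: (@le_trans _ _ (\int[nu]_y' (cst (V N y + e * N%:R)%:E) y')%E).
    have Vy y' : V N y' <= V N y + e * N%:R.
      by have := osc y' y; rewrite ler_norml => /andP[_]; rewrite lerBlDl.
    apply: ge0_le_integral => //.
    - by move=> y' _; rewrite lee_fin.
    - by move=> y' _; rewrite lee_fin.
  by rewrite integral_cst// [X in (_ * X)%E]probability_setT mule1.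
have lo : V N y - e * N%:R <= N%:R * fine sigma2.
  (* Truncating at 0 keeps the constant integrand nonnegative, as integral monotonicity here
     asks. *)
  apply: (@le_trans _ _ (Num.max 0 (V N y - e * N%:R))); first by rewrite le_max lexx orbT.
  rewrite -lee_fin -I.
  apply: (@le_trans _ _ (\int[nu]_y' (cst (Num.max 0 (V N y - e * N%:R))%:E) y')%E).
    by rewrite integral_cst// [X in (_ * X)%E]probability_setT mule1.
  apply: ge0_le_integral => //.
  - by move=> y' _; rewrite lee_fin le_max lexx.
  - move=> y' _; rewrite lee_fin ge_max V_ge0/=.
    by have := osc y y'; rewrite ler_norml => /andP[_]; rewrite lerBlDl lerBlDr addrC.
rewrite -(ler_pM2r N0') -[X in _ * X <= _]gtr0_norm// -normrM mulrBl divfK ?gt_eqF//.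
rewrite (mulrC (fine _)) ler_distl; apply/andP; split; lra.
Qed.

Lemma Lambda_bounds e x : 0 < e -> \forall lam \near (0 : R)^',
  ((lam * ell + lam ^+ 2 * (fine sigma2 / 2 - e))%:E <= Lambda_minus o p g x lam)%E /\
  (Lambda_plus o p g x lam <= (lam * ell + lam ^+ 2 * (fine sigma2 / 2 + e))%:E)%E.
Proof.
move=> e0; have [N N0 HN] := second_moment_uniform e0.
pose u := corrector T f p N.
have [U uU] : exists U, forall y, `|u y| <= U.
  exact: (corrector_bounded T p_ge0 alpha_gt0 b_ge0 f_le pG_cvg N).
have key y : `|ov y + mean p (fun k => u (T k y)) - u y - fine sigma2| <= e.
  by rewrite (corrector_eq T p_ge0 p_sum1 alpha_gt0 b_ge0 f_le pG_cvg mean_f).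
(* One [e] covers the error in [key], the other is the margin asked by the tilted mean lemmas; the
   factor [lam ^+ 2 / 2] turns [2 * e] into [lam ^+ 2 * e]. *)
pose s1 := fine sigma2 + 2 * e; pose s2 := fine sigma2 - 2 * e.
have k1 y : ov y + mean p (fun k => u (T k y)) - u y <= s1 - e.
  by have := key y; rewrite ler_norml /s1 => /andP[_ h]; lra.
have k2 y : s2 + e <= ov y + mean p (fun k => u (T k y)) - u y.
  by have := key y; rewrite ler_norml /s2 => /andP[h _]; lra.
have [del1 del10 H1] :=
  tilted_mean_le1 p_ge0 p_sum1 alpha_gt0 b_ge0 f_le pG_cvg mean_f uU e0 k1.
have [del2 del20 H2] :=
  tilted_mean_ge1 p_ge0 p_sum1 alpha_gt0 b_ge0 f_le pG_cvg mean_f uU e0 k2.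
apply: (@near_dnbhs0 _ _ (Num.min alpha (Num.min del1 del2))).
  by rewrite !lt_min alpha_gt0 del10.
move=> lam; rewrite !le_min => /and3P[lama lam1 lam2] _.
(* Logarithm of the approximate eigenfunction: [psi] corrects the drift at first order, [u] the
   variance at second order. *)
pose H y := lam * psi y + lam ^+ 2 / 2 * u y.
pose c := `|lam| * M + lam ^+ 2 / 2 * U.
have l20 : 0 <= lam ^+ 2 / 2 by rewrite divr_ge0 ?sqr_ge0.
have Hc y : `|H y| <= c.
  rewrite (le_trans (ler_normD _ _))// (normrM lam) (normrM (lam ^+ 2 / 2)).
  by rewrite (ger0_norm l20) lerD// ler_wpM2l.
pose beta s := lam * ell + lam ^+ 2 / 2 * s.
have tE s y : (fun k => expR (lam * busemann o (g k) y + H (act o (g k) y) - H y - beta s)) =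
    (fun k => expR (lam * f k y + lam ^+ 2 / 2 * (u (T k y) - u y - s))).
  by apply/funext => k; congr expR; rewrite /H /beta /f /T; ring.
have tc s y : cvgn (series (fun k => p k *
    expR (lam * busemann o (g k) y + H (act o (g k) y) - H y - beta s))).
  under eq_fun do rewrite (congr1 (fun h => h _) (tE s y)).
  exact: (tilted_cvg p_ge0 alpha_gt0 b_ge0 f_le pG_cvg).
have up n : (mgf o p g x lam n <= (expR (H x + n%:R * beta s1 + c))%:E)%E.
  by apply: mgf_le => // y; rewrite tE; exact: H1.
have lo n : ((expR (H x + n%:R * beta s2 - c))%:E <= mgf o p g x lam n)%E.
  by apply: mgf_ge => // y; rewrite tE; exact: H2.
have := Hc x; rewrite ler_norml => /andP[Hlo Hup].
have -> : lam * ell + lam ^+ 2 * (fine sigma2 / 2 - e) = beta s2.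
  by rewrite /beta /s2; field.
have -> : lam * ell + lam ^+ 2 * (fine sigma2 / 2 + e) = beta s1.
  by rewrite /beta /s1; field.
split.
(* One [c] bounds [H x], the other is the loss in the moment bound; both vanish after division by
   [n]. *)
- apply: (@limn_einf_ge_near _ _ _ (2 * c)) => n n0.
  have n0' : 0 < n%:R :> R by rewrite ltr0n.
  have [h _] := eln_bounds (lo n) (up n).
  apply: le_trans (lee_wpmul2l (x := (n%:R^-1)%:E) _ h); last by rewrite lee_fin invr_ge0 ltW.
  rewrite -EFinM lee_fin [leRHS]mulrC ler_pdivlMr// mulrBl divfK ?gt_eqF//.
  by rewrite (mulrC (beta _)); lra.
- apply: (@limn_esup_le_near _ _ _ (2 * c)) => n n0.
  have n0' : 0 < n%:R :> R by rewrite ltr0n.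
  have [_ h] := eln_bounds (lo n) (up n).
  apply: le_trans (lee_wpmul2l (x := (n%:R^-1)%:E) _ h) _; first by rewrite lee_fin invr_ge0 ltW.
  rewrite -EFinM lee_fin [leLHS]mulrC ler_pdivrMr// mulrDl divfK ?gt_eqF//.
  by rewrite (mulrC (beta _)); lra.
Qed.

Lemma Lambda_rescaled_cvg x :
  ((fun lam : R => (Lambda_minus o p g x lam - (ell * lam)%:E) * (lam ^- 2)%:E)
     @ (0%R : R)^' --> (fine sigma2 / 2)%:E)%E /\
  ((fun lam : R => (Lambda_plus o p g x lam - (ell * lam)%:E) * (lam ^- 2)%:E)
     @ (0%R : R)^' --> (fine sigma2 / 2)%:E)%E.
Proof.
(* [Lambda_bounds] controls [Lambda_minus] from below and [Lambda_plus] from above; this ordering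
   supplies the two missing sides. *)
have le_pm lam : (Lambda_minus o p g x lam <= Lambda_plus o p g x lam)%E.
  exact: limn_einf_sup.
have resc (lam m : R) (L : \bar R) : lam != 0 ->
    (((lam * ell + lam ^+ 2 * m)%:E <= L ->
      m%:E <= (L - (ell * lam)%:E) * (lam ^- 2)%:E)%E) *
    ((L <= (lam * ell + lam ^+ 2 * m)%:E ->
      (L - (ell * lam)%:E) * (lam ^- 2)%:E <= m%:E)%E).
  move=> lam0; have l2 : 0 < lam ^- 2 by rewrite invr_gt0 exprn_even_gt0.
  have E : (m%:E = ((lam * ell + lam ^+ 2 * m)%:E - (ell * lam)%:E) * (lam ^- 2)%:E)%E.
    by rewrite -EFinB -EFinM; congr EFin; field.
  have l2' : (0 <= (lam ^- 2)%:E)%E by rewrite lee_fin ltW.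
  by split => h; [rewrite [leLHS]E|rewrite [leRHS]E];
    apply: lee_wpmul2r => //; apply: leeD2r.
have neq0 : \forall lam \near (0 : R)^', lam != 0 by exact: nbhs_dnbhs_neq.
split; apply: cvge_between => e e0;
  apply: filterS2 (Lambda_bounds x e0) neq0 => lam [lo up] lam0; split.
- exact: (resc _ _ _ lam0).1.
- by apply: (resc _ _ _ lam0).2; exact: le_trans (le_pm lam) up.
- by apply: (resc _ _ _ lam0).1; exact: le_trans lo (le_pm lam).
- exact: (resc _ _ _ lam0).2.
Qed.

Lemma sigma2E : sigma2 = (\int[nu]_y (\sum_(n <oo)
  (p n * (busemann o (g n) y + psi (act o (g n) y) - psi y - ell) ^+ 2)%:E))%E.
Proof.
apply: eq_integral => y _; rewrite /ov /step_var mean_EFin//.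
exact: (step_var_cvg p_ge0 alpha_gt0 b_ge0 f_le pG_cvg).
Qed.

End Walk.

(** * Quadratic expansion at zero for the random walk *)

Theorem theorem4p1
  (R : realType) (X : Type) (d : X -> X -> R) (o : X)
  (* mu = sum_n p n * delta_(g n), a countably supported probability
     measure on Isom(X) *)
  (p : nat -> R) (g : nat -> isom d)
  (* an i.i.d. sequence X_(i+1) = g (I i) with law mu on a probability
     space, used to define ell_mu *)
  (dO : measure_display) (Omega : measurableType dO)
  (P : probability Omega R) (I : nat -> Omega -> nat)
  (ell : R)
  (* bounded measurable psi with int sigma_0(g,x) dmu(g) = ell *)
  (psi : horoT d o -> R)
  (* a mu-stationary probability measure on the horofunction
     compactification *)
  (nu : probability (horoT d o) R) :
  is_metric d -> separable d -> geodesic d -> gromov_hyperbolic d o ->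
  (forall n, 0 <= p n) ->
  (\sum_(n <oo) (p n)%:E = 1)%E ->
  non_elementary o p g ->
  (exists alpha : R, 0 < alpha /\
     (\sum_(n <oo) (p n * expR (alpha * kappa o (g n)))%:E < +oo)%E) ->
  (forall i k, measurable (I i @^-1` [set k])) ->
  (forall n (k : 'I_n -> nat),
     P [set w | forall i : 'I_n, I i w = k i] = (\prod_(i < n) p (k i))%:E) ->
  {ae P, forall w, (fun n : nat => d (walk_o o g I n w) o / n%:R) @ \oo --> ell} ->
  measurable_fun [set: horoT d o] psi ->
  (exists M : R, forall x, `|psi x| <= M) ->
  (forall x : horoT d o,
     (fun N : nat => \sum_(0 <= n < N)
        p n * (busemann o (g n) x + psi (act o (g n) x) - psi x)) @ \oo
       --> ell) ->
  (forall A : set (horoT d o), measurable A ->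
     nu A = (\sum_(n <oo) ((p n)%:E * nu (act o (g n) @^-1` A)))%E) ->
  let sigma2 : \bar R :=
    (\int[nu]_y
       (\sum_(n <oo)
          (p n * (busemann o (g n) y + psi (act o (g n) y) - psi y - ell) ^+ 2)%:E))%E
  in
  sigma2 \is a fin_num /\
  forall x : horoT d o,
    ((fun lam : R => (Lambda_minus o p g x lam - (ell * lam)%:E) * (lam ^- 2)%:E)
       @ (0%R : R)^' --> (fine sigma2 / 2)%:E)%E /\
    ((fun lam : R => (Lambda_plus o p g x lam - (ell * lam)%:E) * (lam ^- 2)%:E)
       @ (0%R : R)^' --> (fine sigma2 / 2)%:E)%E.
Proof.
move=> d_metric _ _ _ p_ge0 p_sum _ [alpha [alpha_gt0 moment]] _ _ _ psi_meas
  [M psi_le] psi_cvg nu_stat sigma2.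
have p_sum1 := nneseries1_cvg p_ge0 p_sum.
have := Lambda_rescaled_cvg d_metric p_ge0 p_sum1 alpha_gt0 moment psi_meas
  psi_le psi_cvg nu_stat.
have := sigma2_fin nu d_metric p_ge0 p_sum1 alpha_gt0 moment psi_meas
  psi_le psi_cvg.
rewrite (sigma2E ell nu d_metric p_ge0 alpha_gt0 moment psi_le).
by split.
Qed.
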